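(* There is a functor $M$ from the category of groups to itself and a natural transformation $i$ from the identity functor on the category of groups to $M$ with the following properties: (1) For all groups $G$ the group $M(G)$ is mitotic; in particular, $M(G)$ is acyclic and $\operatorname{bcd} M(G) = 0$. (2) For all groups $G$, the homomorphism $i_G\colon G\to M(G)$ is injective. (3) If $G$ is an infinite group, then $|M(G)| = |G|$, where $|\cdot|$ denotes the cardinality.
   Context: Conventions: $\mathbb{N}$ contains $0$; for group elements $g,h$ write $g^h := h\cdot g\cdot h^{-1}$; $[\cdot,\cdot]$ denotes the commutator. A group $G$ is acyclic if $H_k(G;\mathbb{Z})\cong 0$ for all $k\in\mathbb{N}_{>0}$. Mitosis: Let $G$ be a subgroup of a group $M$. Then $M$ is a mitosis of $G$ if there exist $s,d\in M$ such that (1) $M$ is generated by $G\cup\{s,d\}$; (2) for all $g\in G$ we have $g^d = g\cdot g^s$; (3) for all $g,g'\in G$ we have $[g',g^s]=1$. A group $M$ is mitotic if for every finitely generated subgroup $G\subset M$ there exists a subgroup $M'\subset M$ such that $G\subset M'$ and $M'$ is a mitosis of $G$. Bounded cohomology: For a group $G$ and $k\in\mathbb{N}$ let $C_k(G;\mathbb{R}) := \bigoplus_{g\in G^k}\mathbb{R}\cdot g$ with boundary operator $\partial_k(g_1,\dots,g_k) = (g_2,\dots,g_k)+\sum_{j=1}^{k-1}(-1)^j (g_1,\dots,g_j g_{j+1},\dots,g_k)+(-1)^k(g_1,\dots,g_{k-1})$, and let $\|\cdot\|_1$ be the $\ell^1$-norm with respect to the basis $G^k$. The bounded cochain complex $C_b^*(G;\mathbb{R})$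 is the topological dual of $C_*(G;\mathbb{R})$ with respect to $\|\cdot\|_1$ (bounded linear functionals, with the dual coboundary operator). Its cohomology is the bounded cohomology $H_b^*(G;\mathbb{R})$. Bounded-cohomological dimension: $\operatorname{bcd}(G) := \sup\{n\in\mathbb{N} \mid H_b^n(G;\mathbb{R})\not\cong 0\}\in\mathbb{N}\cup\{\infty\}$. *)

(* Defs.v *)
From HB Require Import structures.
From mathcomp Require Import all_boot all_order all_algebra.
From mathcomp Require Import all_classical all_reals.
From mathcomp Require Import ereal.
From mathcomp Require Import freeg.

Set Implicit Arguments.
Unset Strict Implicit.
Unset Printing Implicit Defensive.

Import Order.TTheory GRing.Theory Num.Theory.

Local Open Scope classical_set_scope.
Local Open Scope ring_scope.

(* A [groupType] carries a choice structure. Classically every type has one, and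
   morphisms ignore it, so this is the category of groups up to equivalence. *)

Record group_functor := GroupFunctor {
  fobj :> groupType -> groupType;
  fmap : forall G H : groupType,
    {multiplicative G -> H} -> {multiplicative fobj G -> fobj H};
  fmap_id : forall G : groupType,
    fmap (idfun : {multiplicative G -> G}) =1 idfun;
  fmap_comp : forall (G H K : groupType)
      (f : {multiplicative G -> H}) (g : {multiplicative H -> K}),
    fmap (g \o f : {multiplicative G -> K}) =1 fmap g \o fmap f
}.

Definition id_functor : group_functor :=
  @GroupFunctor (fun G => G) (fun G H f => f)
    (fun G => frefl _) (fun G H K f g => frefl _).

Record natural_transformation (E F : group_functor) := NaturalTransformation {
  component :> forall G : groupType, {multiplicative E G -> F G};
  naturality : forall (G H : groupType) (f : {multiplicative G -> H}),
    component H \o fmap E f =1 fmap F f \o component G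
}.

Section Mitosis.
Local Open Scope group_scope.
Variable T : groupType.
Implicit Types (A G M : set T) (x y g h : T).

Definition is_subgroup G : Prop :=
  [/\ G 1, forall x y, G x -> G y -> G (x * y) & forall x, G x -> G x^-1].

Definition generated A : set T := smallest is_subgroup A.

Definition finitely_generated G : Prop :=
  exists2 A : set T, finite_set A & G = generated A.

(* The library's [g ^ h] is [h^-1 * g * h]; here [g^h] is [h * g * h^-1]. *)
Definition lconj g h : T := h * g * h^-1.

(* [M] and [G] are subgroups of an ambient group [T], and [M] is a mitosis of
   [G]. *)
Definition is_mitosis G M : Prop :=
  [/\ is_subgroup G, is_subgroup M, G `<=` M &
    exists s d : T, [/\ M s /\ M d,
      M = generated (G `|` [set s; d]),
      forall g, G g -> lconj g d = g * lconj g s &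
      forall g g', G g -> G g' -> [~ g', lconj g s] = 1]].

End Mitosis.

Definition mitotic (T : groupType) : Prop :=
  forall G : set T, is_subgroup G -> finitely_generated G ->
    exists M : set T, [/\ is_subgroup M, G `<=` M & is_mitosis G M].

Section Homology.
Variables (U V W : zmodType) (f : {additive U -> V}) (g : {additive V -> W}).

Definition ker_pred : {pred V} := fun x => g x == 0.

Lemma ker_zmod_closed : zmod_closed ker_pred.
Proof.
split=> [|x y]; first by rewrite unfold_in /ker_pred raddf0.
rewrite !unfold_in /ker_pred => /eqP gx /eqP gy.
by rewrite raddfB gx gy subrr.
Qed.

HB.instance Definition _ := GRing.isZmodClosed.Build V ker_pred ker_zmod_closed.

Record ker := Ker { ker_val :> V; _ : ker_val \in ker_pred }.

HB.instance Definition _ := [isSub for ker_val].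
HB.instance Definition _ := [Choice of ker by <:].
HB.instance Definition _ := [SubChoice_isSubZmodule of ker by <:].

Definition image_pred : {pred ker} :=
  fun z => `[< exists u, f u = ker_val z >].

Lemma image_zmod_closed : zmod_closed image_pred.
Proof.
split=> [|x y]; rewrite !unfold_in /image_pred.
  by apply/asboolP; exists 0; rewrite raddf0.
move=> /asboolP[u fu] /asboolP[v fv].
by apply/asboolP; exists (u - v); rewrite raddfB fu fv.
Qed.

HB.instance Definition _ :=
  GRing.isZmodClosed.Build ker image_pred image_zmod_closed.

Definition homology : zmodType := {ideal_quot image_pred}.

End Homology.

Definition is_zero (V : zmodType) : Prop := forall x : V, x = 0.

Section BarComplex.
Variables (R : nzRingType) (G : groupType).

Definition chain (k : nat) : lmodType R := {freeg (k.-tuple G) / R}.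

Definition face_first k (t : k.+1.-tuple G) : k.-tuple G :=
  [tuple t`_i.+1 | i < k]%g.

(* Entries are indexed from 0: this multiplies the entries [j] and [j + 1]. *)
Definition face_mul k (t : k.+1.-tuple G) (j : 'I_k) : k.-tuple G :=
  [tuple if (i < j)%N then t`_i
         else if i == j then t`_i * t`_i.+1 else t`_i.+1 | i < k]%g.

Definition face_last k (t : k.+1.-tuple G) : k.-tuple G :=
  [tuple t`_i | i < k]%g.

Definition boundary_basis k (t : k.+1.-tuple G) : chain k :=
  << face_first t >>
  + \sum_(j < k) (-1) ^+ j.+1 *: << face_mul t j >>
  + (-1) ^+ k.+1 *: << face_last t >>.

(* In degree 0 the boundary operator is zero; its target is then irrelevant,
   so it is taken to be [chain 0.-1 = chain 0]. *)
Definition boundary (k : nat) : chain k -> chain k.-1 :=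
  match k with
  | 0 => fun=> 0
  | k'.+1 => fglift (@boundary_basis k')
  end.

Lemma boundary_is_additive k : additive (@boundary k).
Proof.
case: k => [|k]; last exact: lift_is_additive.
by move=> x y /=; rewrite subr0.
Qed.

HB.instance Definition _ k :=
  GRing.isAdditive.Build (chain k) (chain k.-1) (@boundary k)
    (@boundary_is_additive k).

Lemma boundary_is_scalable k : scalable (@boundary k).
Proof.
case: k => [|k] a c; first by rewrite /= scaler0.
pose L : {additive chain k.+1 -> chain k} := @boundary k.+1.
have LE x z : L << x *g z >> = x *: boundary_basis z by exact: liftU.
have Lc : L c = \sum_(z <- dom c) coeff z c *: boundary_basis z.
  by rewrite -{1}[c]freeg_sumE raddf_sum; apply: eq_bigr.
rewrite -[RHS]/(a *: L c) Lc scaler_sumr -[LHS]/(L (fgscale a c)) raddf_sum.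
by apply: eq_bigr => z _; rewrite LE scalerA.
Qed.

HB.instance Definition _ k :=
  GRing.isScalable.Build R (chain k) (chain k.-1) *:%R (@boundary k)
    (@boundary_is_scalable k).

End BarComplex.

Definition group_homology (R : nzRingType) (G : groupType) (k : nat) : zmodType :=
  homology (@boundary R G k.+1) (@boundary R G k).

Definition acyclic (G : groupType) : Prop :=
  forall k, (0 < k)%N -> is_zero (group_homology int G k).

Section BoundedCohomology.
Variables (R : realType) (G : groupType).

Definition l1norm k (c : chain R G k) : R := \sum_(t <- dom c) `|coeff t c|.

Definition bounded_functional k : {pred chain R G k -> R} := fun f =>
  `[< (forall (a : R) (c c' : chain R G k), f (a *: c + c') = a * f c + f c') /\
      exists C : R, forall c : chain R G k, `|f c| <= C * l1norm c >].

Lemma bounded_functional_zmod_closed k : zmod_closed (@bounded_functional k).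
Proof.
split=> [|f g]; rewrite !unfold_in.
  apply/asboolP; split=> [a c c'|]; first by rewrite mulr0 addr0.
  by exists 0 => c; rewrite normr0 mul0r.
move=> /asboolP[lf [C fC]] /asboolP[lg [C' gC']]; apply/asboolP; split=> [a c c'|].
  rewrite !fctE lf lg mulrBr opprD !addrA; congr (_ + _).
  by rewrite addrAC.
exists (C + C') => c; rewrite mulrDl.
by apply: (le_trans (ler_normB _ _)); apply: lerD.
Qed.

HB.instance Definition _ k :=
  GRing.isZmodClosed.Build (chain R G k -> R) (@bounded_functional k)
    (@bounded_functional_zmod_closed k).

(* The topological dual of [(chain R G k, l1norm)]. *)
Record bounded_cochain k := BoundedCochain {
  cochain_val :> chain R G k -> R;
  _ : cochain_val \in @bounded_functional k
}.

HB.instance Definition _ k := [isSub for @cochain_val k].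
HB.instance Definition _ k := [Choice of bounded_cochain k by <:].
HB.instance Definition _ k := [SubChoice_isSubZmodule of bounded_cochain k by <:].

Lemma l1norm_sub k (c : chain R G k) (s : seq (k.-tuple G)) :
  uniq s -> {subset dom c <= s} -> l1norm c = \sum_(t <- s) `|coeff t c|.
Proof.
move=> us sub; rewrite (bigID (fun t => t \in dom c)) /= [X in _ + X]big1 ?addr0.
  rewrite -big_filter; apply: perm_big; apply: uniq_perm.
  - exact: uniq_dom.
  - exact: filter_uniq.
  - by move=> t; rewrite mem_filter; case: (boolP (t \in dom c)) => // /sub ->.
by move=> t /coeff_outdom ->; rewrite normr0.
Qed.

Lemma l1norm_ge0 k (c : chain R G k) : 0 <= l1norm c.
Proof. by apply: sumr_ge0. Qed.

Lemma l1norm0 k : l1norm (0 : chain R G k) = 0.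
Proof. by rewrite /l1norm dom0 big_nil. Qed.

Lemma l1normD k (c c' : chain R G k) : l1norm (c + c') <= l1norm c + l1norm c'.
Proof.
pose s := undup (dom c ++ dom c' ++ dom (c + c')).
have us : uniq s by exact: undup_uniq.
rewrite !(@l1norm_sub _ _ s) //;
  try by move=> t tin; rewrite mem_undup !mem_cat tin ?orbT.
rewrite -big_split /=; apply: ler_sum => t _.
by rewrite coeffD ler_normD.
Qed.

Lemma l1normZ k (a : R) (c : chain R G k) : l1norm (a *: c) = `|a| * l1norm c.
Proof.
rewrite (@l1norm_sub _ _ (dom c)) ?uniq_dom //; last exact: domZ_subset.
by rewrite mulr_sumr; apply: eq_bigr => t _; rewrite coeffZ normrM.
Qed.

Lemma l1norm_sum k (I : Type) (s : seq I) (F : I -> chain R G k) :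
  l1norm (\sum_(i <- s) F i) <= \sum_(i <- s) l1norm (F i).
Proof.
elim: s => [|i s IHs]; first by rewrite !big_nil l1norm0.
rewrite !big_cons; apply: (le_trans (l1normD _ _)).
by rewrite lerD2l.
Qed.

Lemma l1norm_basis k (t : k.-tuple G) : l1norm (<< t >> : chain R G k) = 1.
Proof. by rewrite /l1norm domU1 big_seq1 coeffU eqxx mulr1 normr1. Qed.

Lemma l1norm_boundary k (c : chain R G k) :
  l1norm (boundary c) <= k.+1%:R * l1norm c.
Proof.
case: k c => [|k] c; first by rewrite /= l1norm0 mul1r l1norm_ge0.
have E : boundary c = \sum_(t <- dom c) coeff t c *: boundary_basis R t.
  rewrite -{1}[c]freeg_sumE raddf_sum; apply: eq_bigr => t _.
  exact: liftU.
rewrite E; apply: (le_trans (l1norm_sum _ _)).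
rewrite [in leRHS]/l1norm mulr_sumr; apply: ler_sum => t _.
rewrite l1normZ mulrC ler_wpM2r //.
rewrite /boundary_basis; apply: (le_trans (l1normD _ _)).
apply: (@le_trans _ _ ((1 + k%:R) + 1)); last first.
  by rewrite [1 + _]addrC !natr1.
apply: lerD; last by rewrite l1normZ l1norm_basis normrX normrN1 expr1n mulr1.
apply: (le_trans (l1normD _ _)); rewrite l1norm_basis lerD2l.
apply: (le_trans (l1norm_sum _ _)).
under eq_bigr do rewrite l1normZ l1norm_basis normrX normrN1 expr1n mulr1.
by rewrite sumr_const card_ord.
Qed.

Lemma coboundary_subproof k (f : bounded_cochain k.-1) :
  (fun c : chain R G k => f (boundary c)) \in @bounded_functional k.
Proof.
have /asboolP[lf [C fC]] : cochain_val f \in @bounded_functional k.-1.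
  exact: valP.
apply/asboolP; split=> [a c c'|]; first by rewrite linearP lf.
exists (`|C| * k.+1%:R) => c; apply: (le_trans (fC _)).
apply: (@le_trans _ _ (`|C| * l1norm (boundary c))).
  by apply: ler_wpM2r; [exact: l1norm_ge0 | exact: ler_norm].
by rewrite -mulrA; apply: ler_wpM2l; last exact: l1norm_boundary.
Qed.

(* The dual of [boundary k], from degree [k - 1] to degree [k]; it is zero for
   [k = 0], where it stands for the map out of the zero cochain group in degree
   -1. *)
Definition coboundary k (f : bounded_cochain k.-1) : bounded_cochain k :=
  BoundedCochain (coboundary_subproof f).

Lemma coboundary_is_additive k : additive (@coboundary k).
Proof. by move=> f g; apply: val_inj; apply/funext. Qed.

HB.instance Definition _ k :=
  GRing.isAdditive.Build (bounded_cochain k.-1) (bounded_cochain k)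
    (@coboundary k) (@coboundary_is_additive k).

End BoundedCohomology.

Definition bounded_cohomology (R : realType) (G : groupType) (n : nat) : zmodType :=
  homology (@coboundary R G n)
    (@coboundary R G n.+1 :
      {additive bounded_cochain R G n.+1.-1 -> bounded_cochain R G n.+1}).

(* [is_zero] ignores the vector space structure of the cohomology groups, which
   is irrelevant to their vanishing. The set is never empty, as it contains 0. *)
Definition bcd (R : realType) (G : groupType) : \bar R :=
  ereal_sup [set n%:R%:E | n in [set n | ~ is_zero (bounded_cohomology R G n)]].

(* Main.v *)
Require Import Defs.
From Stdlib Require List.
From HB Require Import structures.
From mathcomp Require Import all_boot all_order all_algebra.
From mathcomp Require Import all_classical all_reals.
From mathcomp Require Import ereal topology normedtype.
From mathcomp Require Import freeg.

Set Implicit Arguments.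
Unset Strict Implicit.
Unset Printing Implicit Defensive.

Import Order.TTheory GRing.Theory Num.Theory.
Import numFieldNormedType.Exports.

Local Open Scope classical_set_scope.
Local Open Scope card_scope.
Local Open Scope ring_scope.

(** Write [g ^ s] for [s * g * s^-1], and let [S] be a finitely generated
    subgroup of a mitotic group. A mitosis of
    [S] contains elements [s] and [d] such that [g ^ d = g * g ^ s], where
    [g ^ s] commutes with [S]. Conjugations act trivially on homology, so the
    homomorphisms [g], [g ^ s] and [g * g ^ s] induce the same map [i] up to
    chain homotopy. As the two factors of [g * g ^ s] commute, that map also
    factors through the product of two copies of [S], where it is homotopic to
    [i + i] plus cross terms made of products of chains of positive degrees;
    hence [i] is homotopic to minus the cross terms. If the inclusion of [S]
    into some [S'] is already null-homotopic in degrees below [k], then the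
    cross terms of degree [k] are null-homotopic too, provided that [s] and [d]
    come from a mitosis of [S']. By induction on [k], for every [k] each finitely
    generated subgroup has an inclusion into another one that is null-homotopic
    in degrees [1] to [k] ([step_null_homotopy], [mitotic_null_homotopy]).

    The homotopies are explicit signed sums of simplices, whose number depends
    on the degree alone. This gives acyclicity at once, since a cycle lives in a
    finitely generated subgroup ([mitotic_acyclic]). For a bounded cocycle it
    gives primitives on all finitely generated subgroups with a common bound,
    and a limit along an ultrafilter is a primitive on the whole group
    ([mitotic_bcd]).

    The functor sends [G] to a group of permutations of [G * X], with [X] the
    set of the sequences in three copies of the natural numbers. An element of
    [G] acts by left translation where all coordinates lie in the first copy. The
    other generators act on a single coordinate, where all later ones lie in the
    first copy: one swaps the first two copies, the other one maps the first copy
    onto the first two. If elements only involve the coordinates before [n],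
    then conjugation by the two generators at [n] moves them to the second copy,
    respectively spreads them over both ([lconj_spread_at],
    [lconj_swap_at_commute]), which is a mitosis. A morphism acts on the labels in
    [G] and leaves the coordinates alone, whence the functor. If [G] is infinite,
    then it has as many elements as there are generators, and as there are finite
    words in them ([infinite_seq_injective], [card_mext]). *)

(** * Linear extension of maps on generators *)

Section LinearExtension.
Variables (R : nzRingType) (K : choiceType) (M : lmodType R).
Implicit Types (f g : K -> M) (c : {freeg K / R}).

(** A name for [fglift] that carries a structure of linear map. *)
Definition lin f : {freeg K / R} -> M := fglift f.

HB.instance Definition _ f :=
  GRing.isZmodMorphism.Build {freeg K / R} M (lin f) (lift_is_additive f).

Lemma linE f c : lin f c = \sum_(z <- dom c) coeff z c *: f z.
Proof.
rewrite -{1}[c]freeg_sumE raddf_sum; apply: eq_bigr => z _; exact: liftU.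
Qed.

Lemma lin_is_scalable f : scalable (lin f).
Proof.
move=> a c; rewrite -[LHS]/(lin f (fgscale a c)) raddf_sum [lin f c]linE scaler_sumr.
apply: eq_bigr => z _; rewrite scalerA; exact: liftU.
Qed.

HB.instance Definition _ f :=
  GRing.isScalable.Build R {freeg K / R} M *:%R (lin f) (lin_is_scalable f).

Lemma linU f x : lin f << x >> = f x.
Proof. by rewrite /lin liftU scale1r. Qed.

Lemma eq_lin_dom f g c : (forall x, x \in dom c -> f x = g x) -> lin f c = lin g c.
Proof.
by move=> fg; rewrite !linE; apply: eq_big_seq => x /fg ->.
Qed.

Lemma eq_lin f g c : f =1 g -> lin f c = lin g c.
Proof. by move=> fg; apply: eq_lin_dom => x _. Qed.

Lemma linD f g c : lin f c + lin g c = lin (fun x => f x + g x) c.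
Proof.
by rewrite !linE -big_split; apply: eq_bigr => x _; rewrite scalerDr.
Qed.

Lemma linN f c : - lin f c = lin (fun x => - f x) c.
Proof.
by rewrite !linE -sumrN; apply: eq_bigr => x _; rewrite scalerN.
Qed.

Lemma linB f g c : lin f c - lin g c = lin (fun x => f x - g x) c.
Proof. by rewrite linN linD. Qed.

Lemma lin_sign n f c : (-1) ^+ n *: lin f c = lin (fun x => (-1) ^+ n *: f x) c.
Proof.
rewrite -signr_odd; case: (odd n); rewrite ?expr0 ?expr1.
  by rewrite scaleN1r linN; apply: eq_lin => x; rewrite scaleN1r.
by rewrite scale1r; apply: eq_lin => x; rewrite scale1r.
Qed.

End LinearExtension.

Lemma lin_comp (R : nzRingType) (K : choiceType) (M M' : lmodType R)
    (F : {linear M -> M'}) (f : K -> M) (c : {freeg K / R}) :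
  F (lin f c) = lin (fun x => F (f x)) c.
Proof.
by rewrite !linE raddf_sum; apply: eq_bigr => x _; rewrite /= linearZZ.
Qed.

Lemma lin_id (R : nzRingType) (K : choiceType) (c : {freeg K / R}) :
  lin (fun x => << x >> : {freeg K / R}) c = c.
Proof.
rewrite linE -[RHS]freeg_sumE; apply: eq_bigr => x _.
apply/eqP/freeg_eqP => y; by rewrite coeffZ !coeffU mul1r.
Qed.

Lemma lin_linear (R : nzRingType) (K : choiceType) (M : lmodType R)
    (F : {linear {freeg K / R} -> M}) (c : {freeg K / R}) :
  lin (fun x => F << x >>) c = F c.
Proof. by rewrite -lin_comp lin_id. Qed.

Lemma lin_lin (R : nzRingType) (K L : choiceType) (M : lmodType R)
    (f : L -> M) (g : K -> L) (c : {freeg K / R}) :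
  lin f (lin (fun x => << g x >>) c) = lin (fun x => f (g x)) c.
Proof. by rewrite lin_comp; apply: eq_lin => x /=; rewrite linU. Qed.

(** * Short combinations of signed generators *)

Section ShortCombinations.
Variable R : nzRingType.

Section Closure.
Variable K : choiceType.
Implicit Types (P : K -> Prop) (c d : {freeg K / R}).

(** All the maps below send a generator to a sum of signed generators. Counting
    these controls the support and the l1 norm together, over the integers and
    over the reals alike. *)
Definition signed_sum (s : seq (bool * K)) : {freeg K / R} :=
  \sum_(p <- s) (-1) ^+ p.1 *: << p.2 >>.

Definition short P n c : Prop :=
  exists s, [/\ (size s <= n)%N, forall p, p \in s -> P p.2 & c = signed_sum s].

Lemma short0 P n : short P n 0.
Proof. by exists [::]; split=> //; rewrite /signed_sum big_nil. Qed.

Lemma shortU P x : P x -> short P 1 << x >>.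
Proof.
move=> Px; exists [:: (false, x)]; split=> //.
  by move=> p; rewrite inE => /eqP ->.
by rewrite /signed_sum big_seq1 scale1r.
Qed.

Lemma shortD P n m c d : short P n c -> short P m d -> short P (n + m) (c + d).
Proof.
move=> [s [sn sP ->]] [t [tm tP ->]]; exists (s ++ t); split.
- by rewrite size_cat leq_add.
- by move=> p; rewrite mem_cat => /orP[/sP|/tP].
- by rewrite /signed_sum big_cat.
Qed.

Lemma shortZ P n c k : short P n c -> short P n ((-1) ^+ k *: c).
Proof.
move=> [s [sn sP ->]]; exists [seq (odd k (+) p.1, p.2) | p <- s]; split.
- by rewrite size_map.
- by move=> p /mapP[q /sP Pq ->].
- rewrite /signed_sum big_map scaler_sumr; apply: eq_bigr => p _ /=.
  by rewrite scalerA signr_addb signr_odd.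
Qed.

Lemma shortN P n c : short P n c -> short P n (- c).
Proof. by move/(@shortZ P n c 1); rewrite expr1 scaleN1r. Qed.

Lemma shortB P n m c d : short P n c -> short P m d -> short P (n + m) (c - d).
Proof. by move=> ? /shortN; apply: shortD. Qed.

Lemma shortW P Q n m c : (n <= m)%N -> (forall x, P x -> Q x) ->
  short P n c -> short Q m c.
Proof.
move=> nm PQ [s [sn sP cs]]; exists s; split=> //; first exact: leq_trans sn nm.
by move=> p /sP /PQ.
Qed.

Lemma eq_lin_short (M : lmodType R) (f g : K -> M) P n c : short P n c ->
  (forall x, P x -> f x = g x) -> lin f c = lin g c.
Proof.
move=> [s [_ sP ->]] fg; rewrite !raddf_sum; apply: eq_big_seq => p /sP /fg E.
by rewrite /= !linearZZ /= !linU E.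
Qed.

Lemma lin_short0 (M : lmodType R) (f : K -> M) P n c : short P n c ->
  (forall x, P x -> f x = 0) -> lin f c = 0.
Proof.
move=> [s [_ sP ->]] f0; rewrite raddf_sum big1_seq // => p /andP[_ /sP /f0 E].
by rewrite /= linearZZ /= linU E scaler0.
Qed.

End Closure.

Lemma short_lin (K L : choiceType) (f : K -> {freeg L / R}) P Q n m c :
  short P n c -> (forall x, P x -> short Q m (f x)) -> short Q (n * m) (lin f c).
Proof.
move=> [s [sn sP ->]] fQ; apply: (@shortW _ Q Q (size s * m)) => //.
  by rewrite leq_mul2r sn orbT.
rewrite raddf_sum => {sn}; elim: s sP => [|p s IHs] sP.
  by rewrite big_nil; exact: short0.
rewrite big_cons mulSn; apply: shortD; last first.
  by apply: IHs => q qs; apply: sP; rewrite inE qs orbT.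
rewrite /= linearZZ /= linU; apply: shortZ; apply: fQ; apply: sP; exact: mem_head.
Qed.

Lemma short_map (K L : choiceType) (f : K -> L) (P : K -> Prop) (Q : L -> Prop) n
    (c : {freeg K / R}) :
  short P n c -> (forall x, P x -> Q (f x)) ->
  short Q n (lin (fun x => << f x >>) c).
Proof.
move=> Pc PQ; rewrite -[n]muln1; apply: short_lin Pc _ => x /PQ; exact: shortU.
Qed.

End ShortCombinations.

(** * Simplices with vertices in a group *)

Section Words.
Variables (R : nzRingType) (T : choiceType).
Implicit Types (x y : seq T) (a b : T) (S : set T).

Local Notation W := {freeg (seq T) / R}.

(** The words of size [n] are the simplices of dimension [n - 1]; the empty word
    generates the augmentation, in degree [-1]. *)
Definition word S n x : Prop := size x = n /\ {in x, forall a, S a}.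

Lemma word_cons S n a x : word S n.+1 (a :: x) <-> S a /\ word S n x.
Proof.
split=> [[/= [sx] xS]|[Sa [/= sx xS]]]; split=> //=.
- by apply: xS; exact: mem_head.
- by split=> // b bx; apply: xS; rewrite inE bx orbT.
- by rewrite sx.
- by move=> b; rewrite inE => /orP[/eqP ->|/xS].
Qed.

Lemma wordS S S' n x : S `<=` S' -> word S n x -> word S' n x.
Proof. by move=> SS' [sx xS]; split=> // a /xS /SS'. Qed.

Definition cone a : W -> W := lin (fun x => << a :: x >>).
HB.instance Definition _ a := GRing.Linear.on (cone a).

(** This is the alternating sum of the faces: the face of [a :: x] opposite to
    [a] is [x], and the others are cones over the faces of [x]. *)
Fixpoint bd x : W := if x is a :: x' then << x' >> - cone a (bd x') else 0.

Lemma bd_cons a x : bd (a :: x) = << x >> - cone a (bd x).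
Proof. by []. Qed.

Lemma bd_nil : bd [::] = 0.
Proof. by []. Qed.

Arguments bd : simpl never.

(** Coning contracts the augmented complex. *)
Lemma bd_cone a c : lin bd (cone a c) = c - cone a (lin bd c).
Proof.
by rewrite [LHS]lin_lin [cone a _]lin_comp -[X in X - _]lin_id linB; exact: eq_lin.
Qed.

Lemma bdK x : lin bd (bd x) = 0.
Proof.
elim: x => [|a x IHx]; rewrite ?raddf0 // bd_cons raddfB /= linU bd_cone IHx.
by rewrite raddf0 subr0 subrr.
Qed.

Lemma short_cone S n k a c : S a -> short (word S n) k c ->
  short (word S n.+1) k (cone a c).
Proof. by move=> Sa /short_map; apply=> x Sx; exact/word_cons. Qed.

Lemma short_bd S n x : word S n x -> short (word S n.-1) n (bd x).
Proof.
elim: x n => [|a x IHx] n; first by move=> [<- _]; exact: short0.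
case: n => [|n]; first by case.
move/word_cons => [Sa Sx]; rewrite bd_cons -add1n; apply: shortB; first exact: shortU.
case: n Sx => [[]|n Sx]; first by case: x {IHx} => //= _ _; rewrite raddf0; exact: short0.
by apply: short_cone => //; exact: IHx.
Qed.

Definition mapw (f : T -> T) : W -> W := lin (fun x => << map f x >>).
HB.instance Definition _ f := GRing.Linear.on (mapw f).

Lemma mapw_cone f a c : mapw f (cone a c) = cone (f a) (mapw f c).
Proof. by rewrite /mapw /cone !lin_lin. Qed.

Lemma bd_map f x : bd (map f x) = mapw f (bd x).
Proof.
elim: x => [|a x IHx] /=; first by rewrite raddf0.
by rewrite !bd_cons raddfB /= IHx mapw_cone /mapw linU.
Qed.

Lemma bd_mapw f c : lin bd (mapw f c) = mapw f (lin bd c).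
Proof. by rewrite /mapw lin_lin lin_comp; apply: eq_lin => x; rewrite bd_map. Qed.

Lemma short_mapw S S' n k f c : (forall a, S a -> S' (f a)) ->
  short (word S n) k c -> short (word S' n) k (mapw f c).
Proof.
move=> SS' /short_map; apply=> x [sx xS]; split; first by rewrite size_map.
by move=> b /mapP[a /xS /SS' ? ->].
Qed.

(** * Null-homotopies by coning *)

Section ConeHomotopy.
Variables (F : seq T -> W) (p : T -> T).

(** A chain map that vanishes in degree [-1] is null-homotopic: cone off what
    the homotopy in lower degrees leaves. The apex lies over the first vertex of
    the simplex, which makes the homotopy as equivariant as [F] and [p] are. *)
Fixpoint cone_htpy_rec n x : W :=
  match n, x with
  | n'.+1, a :: _ => cone (p a) (F x - lin (cone_htpy_rec n') (bd x))
  | _, _ => 0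
  end.

Definition cone_htpy x := cone_htpy_rec (size x) x.

Hypothesis F0 : F [::] = 0.
Hypothesis bdF : forall x, lin bd (F x) = lin F (bd x).

Lemma word_setT x : word setT (size x) x. Proof. by split. Qed.

Lemma lin_cone_htpy x : lin cone_htpy (bd x) = lin (cone_htpy_rec (size x).-1) (bd x).
Proof.
apply: (eq_lin_short (short_bd (word_setT x))) => y [sy _].
by rewrite /cone_htpy sy.
Qed.

Lemma cone_htpyE a x : cone_htpy (a :: x) =
  cone (p a) (F (a :: x) - lin cone_htpy (bd (a :: x))).
Proof. by rewrite lin_cone_htpy. Qed.

Lemma cone_htpyP x : lin bd (cone_htpy x) + lin cone_htpy (bd x) = F x.
Proof.
move Dn: (size x) => n; elim: n x Dn => [|n IHn] [|a x] //.
  by rewrite /= !raddf0 F0 addr0.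
move=> sx; rewrite cone_htpyE bd_cone; (* By induction [Z] is a cycle, so coning recovers it. *)
set Z := F _ - _.
suff -> : lin bd Z = 0 by rewrite raddf0 subr0 /Z subrK.
rewrite /Z raddfB /= bdF [lin bd _]lin_comp linB.
have -> : lin (fun y => F y - lin bd (cone_htpy y)) (bd (a :: x))
        = lin (fun y => lin cone_htpy (bd y)) (bd (a :: x)).
  apply: (eq_lin_short (short_bd (word_setT _))) => y [sy _].
  have yn : size y = n by rewrite sy sx.
  by rewrite -(IHn y yn) addrAC subrr add0r.
by rewrite -lin_comp bdK raddf0.
Qed.

Fixpoint htpy_count (q : nat -> nat) n : nat :=
  if n is n'.+1 then (q n + n * htpy_count q n')%N else 0.

Lemma short_cone_htpy S S' q x n : (forall a, S a -> S' (p a)) ->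
  (forall y m, word S m y -> short (word S' m) (q m) (F y)) ->
  word S n x -> short (word S' n.+1) (htpy_count q n) (cone_htpy x).
Proof.
move=> pS FS; elim: n x => [|n IHn] [|a x] Sx; try by [case: Sx | exact: short0].
rewrite cone_htpyE; apply: short_cone.
  by apply: pS; case/word_cons: Sx.
apply: shortB; first exact: FS.
by apply: short_lin (short_bd Sx) _ => y; exact: IHn.
Qed.

Lemma cone_htpy_map S f g x : {in S, forall a, p (f a) = g (p a)} ->
  (forall y, {in y, forall a, S a} -> F (map f y) = mapw g (F y)) ->
  {in x, forall a, S a} -> cone_htpy (map f x) = mapw g (cone_htpy x).
Proof.
move=> pS FS Sx.
have {Sx} : word S (size x) x by split.
move: (size x) => n; elim: n x => [|n IHn] [|a x] Sx; rewrite /= ?raddf0 //; try by case: Sx.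
have := cone_htpyE (f a) (map f x); rewrite -map_cons => ->.
rewrite cone_htpyE mapw_cone; congr cone; first by rewrite pS // inE; case/word_cons: Sx.
rewrite [RHS]raddfB /=; congr (_ - _); first by apply: (FS (a :: x)); case: Sx.
rewrite -map_cons bd_map [mapw g _]lin_comp [mapw f _]/mapw lin_lin.
by apply: (eq_lin_short (short_bd Sx)) => y /= /IHn.
Qed.

End ConeHomotopy.
End Words.

Arguments bd {R T} x : simpl never.
Arguments short_bd {R T S n x} _.

(** * The Eilenberg-Zilber and Alexander-Whitney maps *)

Section EilenbergZilber.
Variables (R : nzRingType) (T : choiceType) (v : T -> T -> T).
Implicit Types (x y : seq T) (a b : T) (S : set T).

Local Notation W := {freeg (seq T) / R}.

(** The signed sum of the lattice paths from corner to corner of the grid with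
    sides [x] and [y], by the choice of the first step; [v] gives the vertices.
    The values on empty words are those of the augmentation of [y], placed so
    that [bd_ez] also holds in degree [0]. *)
Fixpoint ez x : seq T -> W :=
  match x with
  | [::] => fun y => if size y == 1%N then << [::] >> else 0
  | a :: x' =>
    fix ezr y := match y with
    | [::] => 0
    | b :: y' => cone (v a b) (ez x' (b :: y') + (-1) ^+ size x' *: ezr y')
    end
  end.

Lemma ez_nill y : ez [::] y = if size y == 1%N then << [::] >> else 0.
Proof. by []. Qed.

Lemma ez_nilr x : ez x [::] = 0.
Proof. by case: x. Qed.

Lemma ez_cons a x b y : ez (a :: x) (b :: y) =
  cone (v a b) (ez x (b :: y) + (-1) ^+ size x *: ez (a :: x) y).
Proof. by []. Qed.

Arguments ez : simpl never.

Lemma lin_ez_nil_bd y : lin (ez [::]) (bd y) = 0.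
Proof.
case: y => [|b [|c y]]; rewrite ?raddf0 //.
  by rewrite bd_cons bd_nil raddf0 subr0 linU.
case: y => [|d y].
  by rewrite !bd_cons bd_nil !raddf0 addr0 /cone linU raddfB /= !linU /ez /= subrr.
apply: (lin_short0 (short_bd (@word_setT _ [:: b, c, d & y]))) => z [sz _].
by rewrite ez_nill sz.
Qed.

Lemma lin_ez_conel a (w : W) c y : lin (fun u => ez u (c :: y)) (cone a w) =
  cone (v a c) (lin (fun u => ez u (c :: y)) w
                + lin (fun u => (-1) ^+ size u *: ez (a :: u) y) w).
Proof.
rewrite linD [RHS]lin_comp [in LHS]/cone lin_lin; apply: eq_lin => u; exact: ez_cons.
Qed.

Lemma lin_ez_coner a x c (w : W) : lin (ez (a :: x)) (cone c w) =
  cone (v a c) (lin (fun u => ez x (c :: u)) w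
                + (-1) ^+ size x *: lin (ez (a :: x)) w).
Proof.
by rewrite lin_sign linD [RHS]lin_comp [in LHS]/cone lin_lin; apply: eq_lin.
Qed.

Lemma lin_sign_bd (M : lmodType R) (f : seq T -> M) x :
  lin (fun u => (-1) ^+ size u *: f u) (bd x) = (-1) ^+ (size x).+1 *: lin f (bd x).
Proof.
case: x => [|a x]; first by rewrite bd_nil !raddf0.
rewrite lin_sign; apply: (eq_lin_short (short_bd (@word_setT _ (a :: x)))) => u [-> _].
by rewrite /= !exprS !mulN1r opprK.
Qed.

(** The Leibniz rule; a word [x] has degree [size x - 1], of the parity of
    [(size x).+1]. Inner edges of the grid are reached by two paths of opposite
    signs. *)
Lemma bd_ez x y : lin bd (ez x y) =
  lin (fun u => ez u y) (bd x) + (-1) ^+ (size x).+1 *: lin (ez x) (bd y).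
Proof.
elim: x y => [|a x IHx] y.
  rewrite lin_ez_nil_bd bd_nil raddf0 scaler0 addr0 ez_nill.
  by case: ifP => _; rewrite ?raddf0 // linU bd_nil.
elim: y => [|b y IHy].
  rewrite ez_nilr bd_nil !raddf0 addr0.
  by rewrite (lin_short0 (short_bd (@word_setT _ (a :: x)))) // => u _; rewrite ez_nilr.
rewrite ez_cons bd_cone; set w := ez x (b :: y) + _.
rewrite !bd_cons !raddfB /= !linU lin_ez_conel lin_ez_coner.
have -> : lin bd w = lin bd (ez x (b :: y)) + (-1) ^+ size x *: lin bd (ez (a :: x) y).
  by rewrite linearD linearZZ.
rewrite lin_sign_bd IHx IHy !bd_cons.
have -> : lin (ez^~ y) (<< x >> - cone a (bd x)) = ez x y - lin (ez^~ y) (cone a (bd x)).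
  by rewrite linearB /= linU.
have -> : lin (ez x) (<< y >> - cone b (bd y)) = ez x y - lin (ez x) (cone b (bd y)).
  by rewrite linearB /= linU.
have -> : lin (ez^~ y) (cone a (bd x)) = lin (fun u => ez (a :: u) y) (bd x).
  by rewrite [in LHS]/cone lin_lin.
have -> : lin (ez x) (cone b (bd y)) = lin (fun u => ez x (b :: u)) (bd y).
  by rewrite [in LHS]/cone lin_lin.
have -> : (-1) ^+ (size (a :: x)).+1 = (-1) ^+ size x :> R.
  by rewrite /= !exprS !mulN1r opprK.
rewrite exprS mulN1r /w; set e := (-1) ^+ size x.
move: (lin _ _) (lin _ _) (lin _ _) (lin _ _) (ez x y) => A C D E B.
rewrite -[e *: cone _ _]linearZZ [RHS]addrACA -opprD -[cone _ _ + cone _ _]linearD.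
congr (_ - cone _ _); rewrite !scalerDr !scaleNr !scalerN opprK.
by rewrite -!addrA; congr (_ + _); rewrite [X in _ + X]addrCA addKr addrCA.
Qed.

Lemma ez_point_l a y : y != [::] -> ez [:: a] y = << map (v a) y >>.
Proof.
elim: y => [|b y IHy] // _; rewrite ez_cons ez_nill scale1r.
case: y IHy => [|c y] IHy; first by rewrite /= addr0 /cone linU.
by rewrite IHy //= add0r /cone linU.
Qed.

Lemma ez_point_r x b : x != [::] -> ez x [:: b] = << map (v^~ b) x >>.
Proof.
elim: x => [|a x IHx] // _; rewrite ez_cons ez_nilr scaler0 addr0.
case: x IHx => [|c x] IHx; first by rewrite ez_nill /= /cone linU.
by rewrite IHx // /cone linU.
Qed.

Lemma short_ez S S' S'' m n x y : (forall a b, S a -> S' b -> S'' (v a b)) ->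
  word S m x -> word S' n y -> short (word S'' (m + n).-1) (2 ^ (m + n)) (ez x y).
Proof.
move=> vS; elim: x m y n => [|a x IHx] m y n.
  move=> [<- _] [<- _]; rewrite ez_nill add0n; case: eqP => [->|_]; last exact: short0.
  by apply: (@shortW _ _ (word S'' 0) _ 1) => //; apply: shortU.
case: m => [[]|m] // /word_cons[Sa Sx]; elim: y n => [|b y IHy] n.
  by rewrite ez_nilr => _; exact: short0.
case: n => [[]|n] // Sy; have /word_cons[Sb Sy'] := Sy.
rewrite ez_cons addSn addnS expnS mul2n -addnn /=; apply: short_cone; first exact: vS.
apply: shortD.
- by have := IHx _ _ _ Sx Sy; rewrite addnS.
- by apply: shortZ; exact: IHy Sy'.
Qed.

(** Translations of the factors that [v] turns into a translation [h] of the
    product. *)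
Lemma ez_map S S' f g h x y :
  (forall a b, S a -> S' b -> v (f a) (g b) = h (v a b)) ->
  {in x, forall a, S a} -> {in y, forall b, S' b} ->
  ez (map f x) (map g y) = mapw h (ez x y).
Proof.
move=> vS; elim: x y => [|a x IHx] y Sx.
  move=> _; rewrite !ez_nill size_map; case: ifP => _; last by rewrite linear0.
  by rewrite /mapw linU.
elim: y => [|b y IHy] Sy; first by rewrite !ez_nilr linear0.
have Sa : S a by apply: Sx; exact: mem_head.
have Sb : S' b by apply: Sy; exact: mem_head.
have Sx' : {in x, forall a, S a} by move=> c cx; apply: Sx; rewrite inE cx orbT.
have Sy' : {in y, forall a, S' a} by move=> c cx; apply: Sy; rewrite inE cx orbT.
have IHx' := IHx (b :: y) Sx' Sy; have IHy' := IHy Sy'.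
rewrite /= in IHx' IHy'; rewrite /= !ez_cons IHx' IHy' mapw_cone vS // size_map.
by congr (cone _ _); rewrite [RHS]linearD linearZZ.
Qed.

End EilenbergZilber.

Arguments ez {R T} v x y : simpl never.

Section Diagonal.
Variables (R : nzRingType) (T : choiceType) (M : lmodType R).
Implicit Types (x y : seq T) (a b : T) (S : set T) (G : seq T -> seq T -> M).

(** The Alexander-Whitney diagonal of [x], to which [G] is applied: the sum of
    [G front back] over the vertices of [x]. *)
Fixpoint diag G x : M :=
  if x is a :: x' then G [:: a] x + diag (fun y => G (a :: y)) x' else 0.

Lemma diag_cons G a x :
  diag G (a :: x) = G [:: a] (a :: x) + diag (fun y => G (a :: y)) x.
Proof. by []. Qed.

Lemma diag_nil G : diag G [::] = 0.
Proof. by []. Qed.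

Arguments diag : simpl never.

(** What is used of the fact that [u] and [w] are a front and the matching back of
    [x]: they share a vertex, hence the successor. *)
Definition cut S x (u w : seq T) : Prop :=
  [/\ u != [::], w != [::], (size u + size w = (size x).+1)%N,
      {in u, forall a, S a} & {in w, forall a, S a}].

Lemma eq_diag S G G' x : {in x, forall a, S a} ->
  (forall u w, cut S x u w -> G u w = G' u w) -> diag G x = diag G' x.
Proof.
elim: x G G' => [|a x IHx] G G' Sx GG' //; rewrite !diag_cons.
have Sa : S a by apply: Sx; exact: mem_head.
have Sx' : {in x, forall a, S a} by move=> c cx; apply: Sx; rewrite inE cx orbT.
congr (_ + _).
  by apply: GG'; split=> // b; rewrite inE => /eqP ->.
apply: IHx => // u w [u0 w0 sz uS wS]; apply: GG'; split=> //=.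
  by rewrite addSn sz.
by move=> b; rewrite inE => /orP[/eqP ->|/uS].
Qed.

Lemma size_cut k (x u w : seq T) : (size x <= k.+2)%N ->
  (size u + size w)%N = (size x).+1 -> (1 < size w)%N -> (size u <= k.+1)%N.
Proof.
move=> xk sz w1; rewrite -(leq_add2r 2) !addn2 -addn2.
by rewrite (leq_trans (n := size u + size w)) ?leq_add2l // sz.
Qed.

Lemma diag_map G f x :
  diag G (map f x) = diag (fun u w => G (map f u) (map f w)) x.
Proof. by elim: x G => [|a x IHx] G //; rewrite map_cons !diag_cons IHx. Qed.

Lemma diagD G G' x : diag (fun u w => G u w + G' u w) x = diag G x + diag G' x.
Proof.
by elim: x G G' => [|a x IHx] G G'; rewrite ?diag_nil ?addr0 // !diag_cons IHx addrACA.
Qed.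

Lemma diagN G x : diag (fun u w => - G u w) x = - diag G x.
Proof. by elim: x G => [|a x IHx] G; rewrite ?diag_nil ?oppr0 // !diag_cons IHx opprD. Qed.

(** The two end terms are those where one of the factors is a vertex. *)
Lemma diag_ends G x : (1 < size x)%N ->
  diag G x = G (take 1 x) x + G x (drop (size x).-1 x)
    + diag (fun u w => if (size u <= 1)%N || (size w <= 1)%N then 0 else G u w) x.
Proof.
have last_end H z : z != [::] ->
    diag H z = H z (drop (size z).-1 z)
               + diag (fun u w => if (size w <= 1)%N then 0 else H u w) z.
  elim: z H => [|a [|b z] IHz] H // _; first by rewrite !diag_cons !diag_nil !addr0.
  by rewrite !(diag_cons _ a) IHz // addrCA.
case: x => [|a [|b x]] // _; rewrite !(diag_cons _ a) /= add0r -addrA last_end //.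
Qed.

(** The composite of [G] with the differential of a tensor product. *)
Definition delta G u w : M :=
  lin (fun u' => G u' w) (bd u) + (-1) ^+ (size u).+1 *: lin (G u) (bd w).

Lemma delta_cons G a u w :
  delta G (a :: u) w = G u w - delta (fun u' => G (a :: u')) u w.
Proof.
rewrite /delta bd_cons linearB /= linU [in LHS]/cone lin_lin opprD addrA.
by rewrite [(-1) ^+ (size u).+2]exprS mulN1r scaleNr.
Qed.

(** The diagonal is a chain map: the terms where a front loses its last vertex
    cancel those where a back loses its first one. The terms with an empty word
    come from the augmentation. *)
Lemma diag_delta G x : x != [::] ->
  diag (delta G) x =
  lin (diag G) (bd x) + G [::] x + (-1) ^+ (size x).+1 *: G x [::].
Proof.
elim: x G => [|a x IHx] G // _; rewrite diag_cons.
have -> : delta G [:: a] (a :: x) =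
    G [::] (a :: x) + (G [:: a] x - lin (fun z => G [:: a] (a :: z)) (bd x)).
  rewrite /delta bd_cons bd_nil linear0 subr0 linU /= expr2 mulN1r opprK scale1r.
  by rewrite bd_cons linearB /= linU /cone lin_lin.
have -> : diag (fun u => delta G (a :: u)) x =
    diag G x - diag (delta (fun u => G (a :: u))) x.
  rewrite -diagN -diagD; apply: (@eq_diag setT) => // u w _; exact: delta_cons.
have -> : lin (diag G) (bd (a :: x)) =
    diag G x - (lin (fun z => G [:: a] (a :: z)) (bd x)
                + lin (diag (fun u => G (a :: u))) (bd x)).
  by rewrite bd_cons linearB /= linU [in LHS]/cone lin_lin linD.
case: x IHx => [|b x] IHx.
  rewrite !bd_nil !diag_nil !linear0 /= expr2 mulN1r opprK scale1r.
  by rewrite !addr0 subr0 add0r.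
rewrite IHx // [(-1) ^+ (size (a :: _)).+1]exprS mulN1r scaleNr.
set e := (-1) ^+ _ *: _; move: (lin _ _) (lin _ _) => A B.
move: (G [:: a] _) (diag G _) (G [::] _) => C D E.
rewrite !opprD !addrA; congr (_ - _).
rewrite -!addrA [RHS]addrC -!addrA [C + _]addrC -!addrA addNr addr0.
by rewrite addrCA; congr (_ + _); rewrite [D - A]addrC addrCA.
Qed.

End Diagonal.

Arguments diag {R T M} G x : simpl never.

Lemma linear_diag (R : nzRingType) (T : choiceType) (M M' : lmodType R)
    (F : {linear M -> M'}) (G : seq T -> seq T -> M) x :
  F (diag G x) = diag (fun u w => F (G u w)) x.
Proof.
elim: x G => [|a x IHx] G; first by rewrite !diag_nil linear0.
by rewrite !diag_cons linearD IHx.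
Qed.

Lemma short_diag (R : nzRingType) (T L : choiceType) S P n x
    (G : seq T -> seq T -> {freeg L / R}) :
  {in x, forall a, S a} -> (forall u w, cut S x u w -> short P n (G u w)) ->
  short P (size x * n) (diag G x).
Proof.
elim: x G => [|a x IHx] G Sx GP; first exact: short0.
have Sa : S a by apply: Sx; exact: mem_head.
have Sx' : {in x, forall a, S a} by move=> c cx; apply: Sx; rewrite inE cx orbT.
rewrite diag_cons /= mulSn; apply: shortD.
  by apply: GP; split=> // b; rewrite inE => /eqP ->.
apply: IHx => // u w [u0 w0 sz uS wS]; apply: GP; split=> //=.
  by rewrite addSn sz.
by move=> b; rewrite inE => /orP[/eqP ->|/uS].
Qed.

(** * Coinvariants *)

Section Coinvariants.
Variables (R : nzRingType) (T : groupType).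
Implicit Types (x y : seq T) (a b : T) (S : set T).

Local Notation W := {freeg (seq T) / R}.

(** Among the translates of a word, the one that starts with [1] represents the
    class: equality under [coinv] is equality of coinvariants. *)
Definition nrm x := map ( *%g (head 1%g x)^-1%g) x.

Definition coinv : W -> W := lin (fun x => << nrm x >>).
HB.instance Definition _ := GRing.Linear.on coinv.

Lemma nrm_tr a x : nrm (map ( *%g a) x) = nrm x.
Proof.
case: x => [|b x] //; rewrite /nrm -map_comp; apply: eq_map => c /=.
by rewrite invgM -mulgA mulKg.
Qed.

Lemma coinv_tr a (c : W) : coinv (mapw ( *%g a) c) = coinv c.
Proof. by rewrite /mapw /coinv lin_lin; apply: eq_lin => x; rewrite nrm_tr. Qed.

Lemma coinv_word x : coinv << nrm x >> = coinv << x >>.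
Proof. by rewrite /coinv !linU nrm_tr. Qed.

End Coinvariants.

Lemma lin0 (R : nzRingType) (K : choiceType) (M : lmodType R) (c : {freeg K / R}) :
  lin (fun=> 0 : M) c = 0.
Proof. by rewrite linE big1 // => z _; rewrite scaler0. Qed.

(** The coefficients of [e] are signs, hence central. *)
Lemma lin_exchange (R : nzRingType) (K L : choiceType) (M : lmodType R)
    (f : K -> L -> M) P n (c : {freeg K / R}) (e : {freeg L / R}) :
  short P n e ->
  lin (fun z => lin (f z) e) c = lin (fun w => lin (f^~ w) c) e.
Proof.
move=> [s [_ _ ->]]; elim: s => [|p s IHs].
  by rewrite /signed_sum big_nil linear0 -[RHS](lin0 _ c); apply: eq_lin => z; rewrite linear0.
have sum_cons (g : L -> M) : lin g (signed_sum R (p :: s)) =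
    (-1) ^+ p.1 *: g p.2 + lin g (signed_sum R s).
  by rewrite /signed_sum big_cons linearD /= linearZZ /= linU.
by rewrite sum_cons -IHs lin_sign linD; apply: eq_lin => z; rewrite sum_cons.
Qed.

(** * Null-homotopies of inclusions of subgroups *)

Section NullHomotopy.
Variables (R : nzRingType) (T : groupType).
Implicit Types (x y u w : seq T) (a b g : T) (S : set T).

Local Notation W := {freeg (seq T) / R}.

(** A null-homotopy, in degrees [1] to [k], of the map induced on coinvariants by
    the inclusion of [S] into [S']. Chains of degree [0] form a direct summand of
    the complex of coinvariants, so [h] can vanish on them. The values of [h] are
    combinations of at most [c m] simplices. *)
Definition null_homotopy S S' k (c : nat -> nat) (h : seq T -> W) : Prop :=
  [/\ forall x, (size x <= 1)%N -> h x = 0,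
      forall m x, (m <= k.+1)%N -> word S m x -> short (word S' m.+1) (c m) (h x),
      forall m g x, (m <= k.+1)%N -> S g -> word S m x ->
        coinv (h (map ( *%g g) x)) = coinv (h x) &
      forall m x, (1 < m <= k.+1)%N -> word S m x ->
        coinv (lin bd (h x) + lin h (bd x)) = coinv << x >> ].

Lemma null_homotopy0 S : null_homotopy S S 0 (fun=> 0%N) (fun=> 0).
Proof.
split=> //; first by move=> *; exact: short0.
by move=> [|[|m]].
Qed.

(** Its values do not depend on the subgroups, only on [k] and [c]. *)
Definition step_count k (c : nat -> nat) m : nat :=
  (htpy_count (fun n => n * 2 ^ n.+1 + 2) m
   + m * ((\max_(i < k.+2) c i) * 2 ^ m.+2))%N.

Section Mitosis.
Variables (S S' S'' : set T) (k : nat) (c : nat -> nat) (h : seq T -> W) (s d : T).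
Hypotheses (SS' : S `<=` S') (S'S'' : S' `<=` S'').
Hypotheses (subS : is_subgroup S) (subS' : is_subgroup S') (subS'' : is_subgroup S'').
Hypotheses (S''s : S'' s) (S''d : S'' d).
Hypothesis conj_d : forall g, S' g -> lconj g d = (g * lconj g s)%g.
Hypothesis conj_s : forall g g', S' g -> S' g' -> [~ g', lconj g s]%g = 1%g.
Hypothesis hP : null_homotopy S S' k c h.

(** On [S' * S'] this is the homomorphism that restricts to [g * g ^ s] on the
    diagonal. *)
Definition vtx a b := (a * lconj b s)%g.

Lemma vtx_l g a b : vtx (g * a)%g b = (g * vtx a b)%g.
Proof. by rewrite /vtx -mulgA. Qed.

Lemma lconjM g g' t : lconj (g * g')%g t = (lconj g t * lconj g' t)%g.
Proof. by rewrite /lconj !mulgA mulgVK. Qed.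

Lemma commute_lconj g a : S' g -> S' a -> (a * lconj g s = lconj g s * a)%g.
Proof. by move=> S'g S'a; apply/commgP/eqP; exact: conj_s. Qed.

Lemma vtx_r g a b : S' g -> S' a -> vtx a (g * b)%g = (lconj g s * vtx a b)%g.
Proof.
by move=> S'g S'a; rewrite /vtx lconjM [LHS]mulgA (commute_lconj S'g S'a) -mulgA.
Qed.

Lemma vtx_d g a b : S' g -> S' a ->
  vtx (g * a)%g (g * b)%g = (lconj g d * vtx a b)%g.
Proof. by move=> S'g S'a; rewrite vtx_l vtx_r // conj_d // [LHS]mulgA. Qed.

Lemma S''_vtx a b : S' a -> S' b -> S'' (vtx a b).
Proof.
have [_ mulS'' invS''] := subS''; move=> /S'S'' Sa /S'S'' Sb.
exact: (mulS'' _ _ Sa (mulS'' _ _ (mulS'' _ _ S''s Sb) (invS'' _ S''s))).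
Qed.

Local Notation E := (ez vtx).

(** The map induced by [g * g ^ s], computed through the product [S' * S']. *)
Definition square x : W := if x is [::] then << [::] >> else diag E x.

Lemma square_bd x : lin bd (square x) = lin square (bd x).
Proof.
have E_nil (y : seq T) : lin square (bd y) = lin (diag E) (bd y) + E [::] y.
  rewrite ez_nill; have [y1|y1] := eqVneq (size y) 1%N.
    case: y y1 => [|a [|b y]] // _.
    by rewrite bd_cons bd_nil linear0 subr0 !linU add0r.
  rewrite addr0; case: y y1 => [|a [|b y]] // _; first by rewrite bd_nil !linear0.
  by apply: (eq_lin_short (short_bd (word_setT _))) => -[|b' y'] [].
case: x => [|a x]; first by rewrite linU bd_nil linear0.
rewrite E_nil linear_diag [LHS](@eq_diag _ _ _ setT _ (delta E)) //; last first.
  by move=> u w _; exact: bd_ez.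
by rewrite diag_delta // ez_nilr scaler0 addr0.
Qed.

(** On the diagonal, [vtx] is the conjugation by [d]. *)
Lemma square_map g x : S' g -> {in x, forall a, S' a} ->
  square (map ( *%g g) x) = mapw ( *%g (lconj g d)) (square x).
Proof.
move=> S'g S'x; case: x S'x => [|a x] S'x; first by rewrite /mapw linU.
rewrite [LHS]/= -map_cons diag_map linear_diag; apply: eq_diag S'x _ => u w [_ _ _ uS wS].
by apply: ez_map uS wS => a' b' ? ?; exact: vtx_d.
Qed.

Lemma short_square m x : word S' m x -> short (word S'' m) (m * 2 ^ m.+1 + 1) (square x).
Proof.
case: x => [|a x] Sx.
  by apply: (@shortW _ _ (word S'' m) _ 1); rewrite ?leq_addl //; apply: shortU; case: Sx.
have [sx S'x] := Sx.
apply: (@shortW _ _ (word S'' m) _ (size (a :: x) * 2 ^ m.+1)%N) => //.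
  by rewrite sx leq_addr.
apply: short_diag S'x _ => u w [_ _ sz uS wS].
have : short (word S'' (size u + size w).-1) (2 ^ (size u + size w)) (E u w : W).
  by apply: short_ez; first exact: S''_vtx.
by rewrite sz sx.
Qed.

Lemma coinv_ez_l (e : W) w : coinv (lin (E^~ w) (coinv e)) = coinv (lin (E^~ w) e).
Proof.
rewrite [in LHS]/coinv lin_lin !lin_comp; apply: eq_lin => z /=.
rewrite -{1}[w]map_id (@ez_map _ _ _ setT setT _ _ ( *%g (head 1 z)^-1)%g) //.
  exact: coinv_tr.
by move=> a b _ _; rewrite vtx_l.
Qed.

(** Right translations of the second factor are left translations of the
    product, because the two factors commute. *)
Lemma coinv_ez_points a b m n (e : W) : S' a -> S' b -> short (word S' m) n e ->
  coinv (lin (E^~ [:: a]) e) = coinv (lin (E^~ [:: b]) e).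
Proof.
move=> S'a S'b Se; have [_ mulS' invS'] := subS'.
have S'ab : S' (a * b^-1)%g by exact: mulS' S'a (invS' _ S'b).
rewrite !lin_comp; apply: eq_lin_short Se _ => z [_ zS].
have := @ez_map R _ vtx S' S' id ( *%g (a * b^-1)%g) ( *%g (lconj (a * b^-1) s))%g z [:: b].
rewrite map_id /= mulgVK => -> //; first exact: coinv_tr.
- by move=> *; exact: vtx_r.
- by move=> b'; rewrite inE => /eqP ->.
Qed.

(** The part of [square] where both factors have positive degree. *)
Definition cross u w : W := if (size u <= 1)%N || (size w <= 1)%N then 0 else E u w.

(** The first factor is replaced by its null-homotopy. In [cross] its degree is
    less than that of the simplex, since the second factor has positive degree. *)
Definition cross_htpy u w : W := if (size w <= 1)%N then 0 else lin (E^~ w) (h u).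

(** [cross_htpy] is a null-homotopy of [cross] on the tensor product. The Leibniz
    rule gives this up to the terms where a face of [w] is a vertex, which cancel
    by [coinv_ez_points]. *)
Lemma cross_htpyP m x u w : (m <= k.+2)%N -> word S m x -> cut S x u w ->
  coinv (lin bd (cross_htpy u w)) = coinv (cross u w) - coinv (delta cross_htpy u w).
Proof.
have [h0 hS hinv hbd] := hP; have [_ mulS invS] := subS.
move=> mk [sx xS] [u0 w0 sz uS wS]; rewrite /cross /cross_htpy.
have [w1|w1] := leqP (size w) 1.
  rewrite orbT !linear0 /delta /cross_htpy w1 lin0 !add0r.
  rewrite (lin_short0 (short_bd (word_setT w))) ?scaler0 ?linear0 ?oppr0 // => y [-> _].
  by rewrite (leq_trans (leq_pred _) w1).
rewrite orbF; have [u1|u1] := leqP (size u) 1.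
  have -> : delta cross_htpy u w = 0.
    rewrite /delta (lin_short0 (short_bd (word_setT u))) => [|y [sy _]]; last first.
      by rewrite /cross_htpy h0 ?linear0 ?if_same // sy (leq_trans (leq_pred _)).
    rewrite add0r -[lin _ _](_ : 0 = _) ?scaler0 //.
    by rewrite -[LHS](lin0 _ (bd w)); apply: eq_lin => y; rewrite /cross_htpy h0 ?linear0 ?if_same.
  by rewrite h0 // !linear0 addr0.
have uk : (size u <= k.+1)%N by apply: size_cut sz w1; rewrite sx.
have uW : word S (size u) u by split.
have Hu := hS _ _ uk uW; have Eu := hbd _ _ (introT andP (conj u1 uk)) uW.
rewrite [lin bd _]lin_comp (eq_lin_short Hu (g := fun z => lin (E^~ w) (bd z)
    + (-1) ^+ (size u).+2 *: lin (E z) (bd w))); last first.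
  by move=> z [sz' _]; rewrite -sz'; exact: bd_ez.
rewrite -linD -lin_sign (lin_exchange _ _ (short_bd (word_setT w))) linearD /=.
rewrite -[lin (fun x => lin _ (bd x)) _]lin_comp /= -coinv_ez_l.
move: Eu; rewrite linearD /= => /(canRL (addrK _)) ->.
rewrite linearB /= !linearB /= !coinv_ez_l linU.
have -> : delta (fun u2 w2 => if (size w2 <= 1)%N then 0 else lin (E^~ w2) (h u2)) u w =
    lin (E^~ w) (lin h (bd u)) + (-1) ^+ (size u).+1 *: lin (cross_htpy u) (bd w).
  rewrite /delta; congr (_ + _); rewrite [RHS]lin_comp; apply: eq_lin => y /=.
  by rewrite leqNgt w1.
rewrite [coinv (_ + _)]linearD opprD addrA; congr (_ + _).
rewrite [LHS]linearZZ /= [in RHS]linearZZ exprS mulN1r scaleNr; congr (- (_ *: _)).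
(* If [w] is an edge, then [cross_htpy u] kills its ends. *)
case: w w0 sz wS w1 {mk} => [|a [|b [|e w]]] // _ sz wS _.
  rewrite !bd_cons bd_nil linear0 subr0 /cone linU [lin _ (_ - _)]linearB /= !linU.
  rewrite [lin (cross_htpy _) _]linearB /= !linU /cross_htpy /= subrr linear0 linearB /=.
  rewrite (@coinv_ez_points a b _ _ _ _ _ Hu) ?subrr //;
    by apply: SS'; apply: wS; rewrite !inE eqxx ?orbT.
congr (coinv _); apply: (eq_lin_short (short_bd (word_setT _))) => y [sy _].
by rewrite /cross_htpy sy.
Qed.

(** Both terms are equivariant over the inclusion of [S'], because the conjugations
    by [d] and [s] have been undone on the vertices; so coning applies to their
    difference. In coinvariants they are the maps induced by [g * g ^ s] and by
    [g ^ s]. *)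
Definition step_base x : W :=
  mapw ( *%g d^-1%g) (square x) - << map (fun a => a * s^-1)%g x >>.

Definition step_htpy x : W :=
  if (size x <= 1)%N then 0 else cone_htpy step_base id x - diag cross_htpy x.

Lemma step_base0 : step_base [::] = 0.
Proof. by rewrite /step_base /mapw linU subrr. Qed.

Lemma step_base_bd x : lin bd (step_base x) = lin step_base (bd x).
Proof.
rewrite /step_base linearB /= bd_mapw square_bd linU bd_map -linB; congr (_ - _).
exact: lin_comp.
Qed.

Lemma step_base_map g x : S' g -> {in x, forall a, S' a} ->
  step_base (map ( *%g g) x) = mapw ( *%g g) (step_base x).
Proof.
move=> S'g S'x; rewrite /step_base square_map // [RHS]linearB /=; congr (_ - _).
  rewrite /mapw !lin_lin; apply: eq_lin => y; rewrite -!map_comp; congr << _ >>.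
  by apply: eq_map => a /=; rewrite /lconj !mulgA mulVg mul1g.
rewrite [RHS]linU -!map_comp; congr << _ >>.
by apply: eq_map => a /=; rewrite mulgA.
Qed.

Lemma short_step_base m x : word S' m x ->
  short (word S'' m) (m * 2 ^ m.+1 + 2) (step_base x).
Proof.
have [_ mulS'' invS''] := subS'' => Sx; rewrite (addnA _ 1%N 1%N); apply: shortB.
  apply: short_mapw (short_square Sx) => a; apply: (mulS''); exact: (invS'').
have [sx xS] := Sx; apply: shortU; split=> [|b]; first by rewrite size_map.
by case/mapP=> a /xS /S'S'' Sa ->; apply: (mulS'') => //; exact: (invS'').
Qed.

(** The end terms of [square] are the maps induced by [g ^ s] and by [g], and the
    former is the one that [step_base] subtracts. *)
Lemma coinv_step_base x : (1 < size x)%N -> {in x, forall a, S' a} ->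
  coinv (step_base x) = coinv << x >> + coinv (diag cross x).
Proof.
move=> x1 S'x; rewrite /step_base linearB /= coinv_tr /square.
case: x x1 S'x => [|a [|b x]] // _ S'x; set y := [:: a, b & x].
have y1 : (1 < size y)%N by [].
have Sl : S' (last a (b :: x)) by apply: S'x; exact: mem_last.
rewrite (diag_ends _ y1) -/cross.
have -> : drop (size y).-1 y = [:: last a (b :: x)].
  by rewrite /y lastI size_rcons -cats1 drop_size_cat.
have P1 : coinv << map (vtx a) y >> = coinv << map (fun a => a * s^-1)%g y >> :> W.
  rewrite -[LHS]coinv_word -[RHS]coinv_word -[in RHS](nrm_tr (a * s)%g) -map_comp.
  congr (coinv << nrm _ >>).
  by apply: eq_map => e; rewrite /vtx /lconj /= !mulgA.
have P2 : coinv << map (vtx^~ (last a (b :: x))) y >> = coinv << y >> :> W.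
  rewrite -[LHS]coinv_word -[RHS]coinv_word -[in RHS](nrm_tr (lconj (last a (b :: x)) s)).
  congr (coinv << nrm _ >>).
  by apply/eq_in_map => e ey; rewrite /vtx commute_lconj //; exact: S'x.
have coinvD (A B C : W) : coinv (A + B + C) = coinv A + coinv B + coinv C.
  by rewrite !linearD.
rewrite ez_point_l // ez_point_r // coinvD P1 P2.
by rewrite -!addrA addrC -!addrA addNr addr0.
Qed.

Lemma cone_step_map g x : S' g -> {in x, forall a, S' a} ->
  cone_htpy step_base id (map ( *%g g) x) = mapw ( *%g g) (cone_htpy step_base id x).
Proof. by move=> S'g; apply: cone_htpy_map => // y; exact: step_base_map. Qed.

Lemma word_translate m g x : S g -> word S m x -> word S m (map ( *%g g) x).
Proof.
have [_ mulS _] := subS => Sg [sx xS]; split; first by rewrite size_map.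
by move=> b /mapP[a /xS Sa ->]; exact: (mulS).
Qed.

Lemma coinv_cross_htpy_map m g x u w : (m <= k.+2)%N -> S g -> word S m x ->
  cut S x u w ->
  coinv (cross_htpy (map ( *%g g) u) (map ( *%g g) w)) = coinv (cross_htpy u w).
Proof.
have [_ hS hinv _] := hP.
move=> mk Sg [sx _] [_ _ sz uS wS]; rewrite /cross_htpy size_map.
have [//|w1] := leqP (size w) 1.
have uk : (size u <= k.+1)%N by apply: size_cut sz w1; rewrite sx.
have uW : word S (size u) u by split.
have Hgu := hS _ _ uk (word_translate Sg uW).
rewrite -[RHS]coinv_ez_l -(hinv _ _ _ uk Sg uW) coinv_ez_l !lin_comp.
apply: (eq_lin_short Hgu) => z [_ zS].
have := @ez_map R _ vtx S' S' id ( *%g g) ( *%g (lconj g s))%g z w.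
rewrite map_id => ->.
- exact: coinv_tr.
- by move=> *; apply: vtx_r => //; exact: SS'.
- by [].
- by move=> a /wS; exact: SS'.
Qed.

Lemma coinv_step_htpy_map m g x : (m <= k.+2)%N -> S g -> word S m x ->
  coinv (step_htpy (map ( *%g g) x)) = coinv (step_htpy x).
Proof.
move=> mk Sg Sx; rewrite /step_htpy size_map; case: ifP => // _.
have [_ xS] := Sx.
rewrite cone_step_map; [|exact: SS'|by move=> a /xS /SS'].
rewrite !linearB /= coinv_tr diag_map; congr (_ - _); rewrite !linear_diag.
apply: eq_diag xS _ => u w; exact: coinv_cross_htpy_map mk Sg Sx.
Qed.

(** Cutting [step_htpy] off in degree [0] makes no difference: there the homotopy
    is equivariant, hence takes the same value on the two ends of an edge. *)
Lemma coinv_lin_step_htpy x : (1 < size x)%N -> {in x, forall a, S a} ->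
  coinv (lin step_htpy (bd x)) =
  coinv (lin (fun y => cone_htpy step_base id y - diag cross_htpy y) (bd x)).
Proof.
case: x => [|a [|b [|e x]]] // _ Sx; last first.
  congr (coinv _); apply: (eq_lin_short (short_bd (word_setT _))) => y [sy _].
  by rewrite /step_htpy sy.
have [_ mulS invS] := subS.
have Sa : S a by apply: Sx; rewrite inE eqxx.
have Sb : S b by apply: Sx; rewrite !inE eqxx orbT.
rewrite !bd_cons bd_nil linear0 subr0 /cone linU !linearB /= !linU /step_htpy /= subrr.
rewrite !diag_cons !diag_nil /cross_htpy /= !addr0 !subr0.
have := @cone_step_map (b * a^-1)%g [:: a] _ _; rewrite /= mulgVK => ->.
- by rewrite coinv_tr subrr.
- by apply: SS'; exact: mulS Sb (invS _ Sa).
- by move=> e; rewrite inE => /eqP ->; exact: SS'.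
Qed.

(** The boundary of [cone_htpy step_base] gives the inclusion plus the cross
    terms, and that of [diag cross_htpy] takes the latter away. *)
Lemma step_null_homotopy : null_homotopy S S'' k.+1 (step_count k c) step_htpy.
Proof.
have [h0 hS hinv hbd] := hP; split.
- by move=> x x1; rewrite /step_htpy x1.
- move=> m x mk Sx; rewrite /step_htpy; case: ifP => _; first exact: short0.
  have [sx xS] := Sx; apply: shortB.
    apply: (short_cone_htpy (S := S')) (wordS SS' Sx); first exact: S'S''.
    by move=> y n; exact: short_step_base.
  rewrite -[m in (m * _)%N]sx; apply: short_diag xS _ => u w [u0 w0 sz uS wS].
  rewrite /cross_htpy; have [_|w1] := leqP (size w) 1; first exact: short0.
  have uk : (size u <= k.+1)%N by apply: size_cut sz w1; rewrite sx.
  have uW : word S (size u) u by split.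
  apply: (@shortW _ _ (word S'' m.+1) _ (c (size u) * 2 ^ m.+2)) => //.
    rewrite leq_mul2r; apply/orP; right.
    exact: (leq_bigmax (F := fun i : 'I_k.+2 => c i) (Ordinal (uk : size u < k.+2)%N)).
  apply: short_lin (hS _ _ uk uW) _ => z Sz.
  have wW : word S' (size w) w by split=> // a /wS /SS'.
  by have := short_ez R S''_vtx Sz wW; rewrite addSn sz sx.
- by move=> m g x mk Sg Sx; exact: coinv_step_htpy_map mk Sg Sx.
move=> m x /andP[m1 mk] Sx; have [sx xS] := Sx.
have x1 : (1 < size x)%N by rewrite sx.
rewrite linearD /= coinv_lin_step_htpy // -linearD /= {1}/step_htpy leqNgt x1 /=.
rewrite linearB /= -linB addrACA -opprD cone_htpyP; last first.
- exact: step_base_bd.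
- exact: step_base0.
rewrite linearB /= coinv_step_base //; last by move=> a /xS /SS'.
rewrite linearD /= !linear_diag.
have -> : diag (fun u w => coinv (lin bd (cross_htpy u w))) x
    = diag (fun u w => coinv (cross u w) - coinv (delta cross_htpy u w)) x.
  apply: eq_diag xS _ => u w; exact: cross_htpyP mk Sx.
rewrite diagD diagN -!linear_diag diag_delta; last by case: x x1 {Sx sx xS}.
have -> : cross_htpy [::] x = 0 by rewrite /cross_htpy h0 // linear0 if_same.
rewrite scaler0 !addr0.
by rewrite /= subrK addrK.
Qed.

End Mitosis.
End NullHomotopy.

(** * Mitotic groups: null-homotopies with uniform bounds *)

Section Generated.
Variable T : groupType.
Implicit Types (A B : set T).

Lemma generated_subgroup A : is_subgroup (generated A).
Proof.
split=> [H [[H1 _ _] _]|x y Ax Ay H [sH AH]|x Ax H [sH AH]] //.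
- by have [_ M _] := sH; apply: (M); [exact: Ax | exact: Ay].
- by have [_ _ V] := sH; apply: (V); exact: Ax.
Qed.

Lemma sub_generated A : A `<=` generated A.
Proof. by move=> x Ax H [_ AH]; exact: AH. Qed.

Lemma generated_min A B : is_subgroup B -> A `<=` B -> generated A `<=` B.
Proof. by move=> sB AB x Ax; apply: Ax. Qed.

Lemma generatedU A B : generated (generated A `|` B) = generated (A `|` B).
Proof.
apply/seteqP; split; apply: generated_min; try exact: generated_subgroup.
  move=> x [|Bx]; last by apply: sub_generated; right.
  by apply: generated_min x; [exact: generated_subgroup | move=> y ?; apply: sub_generated; left].
move=> x [Ax|Bx]; apply: sub_generated; last by right.
by left; exact: sub_generated.
Qed.

Lemma mitosis_finitely_generated A B :
  finitely_generated A -> is_mitosis A B -> finitely_generated B.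
Proof.
move=> [X fX ->] [_ _ _ [s [d [_ -> _ _]]]].
exists (X `|` [set s; d]); last exact: generatedU.
by rewrite finite_setU; split=> //; exact: finite_set2.
Qed.

End Generated.

(** The bounds [c] come before the subgroup: they are uniform. *)
Lemma mitotic_null_homotopy (R : nzRingType) (T : groupType) : mitotic T ->
  forall k, exists c : nat -> nat, forall S : set T,
  is_subgroup S -> finitely_generated S ->
  exists S' h, [/\ is_subgroup S', finitely_generated S', S `<=` S'
                 & @null_homotopy R T S S' k c h].
Proof.
move=> mitT; elim=> [|k [c IHc]].
  exists (fun=> 0%N) => S sS fS; exists S, (fun=> 0); split=> //; exact: null_homotopy0.
exists (step_count k c) => S sS fS.
have [S' [h [sS' fS' SS' hP]]] := IHc S sS fS.
have [S'' [sS'' S'S'' mit]] := mitT S' sS' fS'.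
have fS'' := mitosis_finitely_generated fS' mit.
have [_ _ _ [s [d [[S''s S''d] _ conj_d conj_s]]]] := mit.
exists S'', (step_htpy h s d); split=> //; first exact: subset_trans S'S''.
exact: step_null_homotopy hP.
Qed.

(** * Comparison with the bar complex *)

Section BarComparison.
Variables (R : nzRingType) (T : groupType).
Implicit Types (x : seq T) (a g : T) (S : set T) (k : nat).

Local Notation W := {freeg (seq T) / R}.
Local Notation foldmul := (foldl (fun a b => a * b)%g 1%g).

(** [diffs] and [of_bar] are the isomorphisms between the coinvariants of the
    simplices of dimension [k] and the basis [G ^ k] of the bar complex. *)
Definition diffs k x : k.-tuple T := [tuple ((x`_i)^-1 * x`_i.+1)%g | i < k].

Definition to_bar k : W -> chain R T k :=
  lin (fun x => if size x == k.+1 then << diffs k x >> else 0).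
HB.instance Definition _ k := GRing.Linear.on (to_bar k).

Definition of_bar k (t : k.-tuple T) : seq T :=
  mkseq (fun i => foldmul (take i t)) k.+1.

Lemma size_of_bar k (t : k.-tuple T) : size (of_bar t) = k.+1.
Proof. exact: size_mkseq. Qed.

Lemma foldmul_take (s : seq T) i : (i < size s)%N ->
  foldmul (take i.+1 s) = (foldmul (take i s) * s`_i)%g.
Proof. by move=> si; rewrite (take_nth 1%g si) foldl_rcons. Qed.

Lemma nth_of_bar k (t : k.-tuple T) i : (i <= k)%N ->
  nth 1%g (of_bar t) i = foldmul (take i t).
Proof. by move=> ik; rewrite nth_mkseq. Qed.

Lemma of_bar_step k (t : k.-tuple T) i : (i < k)%N ->
  nth 1%g (of_bar t) i.+1 = (nth 1%g (of_bar t) i * nth 1%g t i)%g.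
Proof.
by move=> ik; rewrite !nth_of_bar ?(ltnW ik) // foldmul_take // size_tuple.
Qed.

Lemma eq_tuple_nth k (t t' : k.-tuple T) :
  (forall i, (i < k)%N -> nth 1%g t i = nth 1%g t' i) -> t = t'.
Proof. by move=> tt'; apply: eq_from_tnth => i; rewrite !(tnth_nth 1%g) tt'. Qed.

Lemma nth_mktuple1 k (f : nat -> T) i : (i < k)%N ->
  nth 1%g [tuple f j | j < k] i = f i.
Proof. by move=> ik; rewrite (nth_mktuple _ _ (Ordinal ik)). Qed.

Lemma nth_diffs k x i : (i < k)%N ->
  nth 1%g (diffs k x) i = ((nth 1%g x i)^-1 * nth 1%g x i.+1)%g.
Proof. exact: (nth_mktuple1 (fun i => (nth 1%g x i)^-1 * nth 1%g x i.+1)%g). Qed.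

Lemma of_barK k (t : k.-tuple T) : diffs k (of_bar t) = t.
Proof.
by apply: eq_tuple_nth => i ik; rewrite nth_diffs // of_bar_step // mulKg.
Qed.

Lemma nth_nrm x i : (i < size x)%N ->
  nth 1%g (nrm x) i = ((head 1%g x)^-1 * nth 1%g x i)%g.
Proof. by move=> ix; rewrite (nth_map 1%g). Qed.

Lemma diffsK k x : size x = k.+1 -> of_bar (diffs k x) = nrm x.
Proof.
move=> sx; apply: (@eq_from_nth _ 1%g); rewrite size_of_bar ?size_map ?sx // => i ik.
rewrite nth_nrm ?sx //; elim: i ik => [|i IHi] ik.
  by rewrite nth_of_bar // take0 /= nth0 mulVg.
by rewrite of_bar_step // IHi ?(ltnW ik) // nth_diffs // -mulgA mulVKg.
Qed.

Lemma diffs_nrm k x : size x = k.+1 -> diffs k (nrm x) = diffs k x.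
Proof.
move=> sx; apply: eq_tuple_nth => i ik.
have ik' : (i < k.+1)%N by exact: ltnW.
rewrite !nth_diffs // !nth_nrm ?sx //.
by rewrite invgM invgK -mulgA mulVKg.
Qed.

Lemma to_bar_coinv k (c : W) : to_bar k (coinv c) = to_bar k c.
Proof.
rewrite /coinv lin_comp; apply: eq_lin => x /=; rewrite /to_bar linU size_map.
by case: eqP => // /diffs_nrm ->.
Qed.

Lemma to_bar_of_bar k (t : k.-tuple T) : to_bar k << of_bar t >> = << t >>.
Proof. by rewrite /to_bar linU size_of_bar eqxx of_barK. Qed.

Definition del i x := take i x ++ drop i.+1 x.

Lemma bd_sum x : bd x = \sum_(i < size x) (-1) ^+ i *: << del i x >> :> W.
Proof.
elim: x => [|a x IHx]; first by rewrite big_ord0.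
rewrite bd_cons big_ord_recl expr0 scale1r /del /= drop0 IHx linear_sum -sumrN.
congr (_ + _); apply: eq_bigr => i _; rewrite linearZZ /= /cone linU.
by rewrite [bump _ _]add1n exprS mulN1r scaleNr.
Qed.

Lemma nth_del i x j : (i < size x)%N -> nth 1%g (del i x) j = nth 1%g x (bump i j).
Proof.
move=> ix; rewrite nth_cat size_takel ?(ltnW ix) //; case: ltnP => ij.
  by rewrite nth_take // /bump leqNgt ij.
by rewrite nth_drop /bump ij addSn subnKC.
Qed.

Lemma size_del i x : (i < size x)%N -> size (del i x) = (size x).-1.
Proof.
move=> ix; rewrite size_cat size_takel ?(ltnW ix) // size_drop.
by rewrite subnS -subn1 addnBA ?subn_gt0 // subnKC ?(ltnW ix) // subn1.
Qed.

Lemma boundary_basisE k (t : k.+1.-tuple T) :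
  boundary_basis R t = to_bar k (bd (of_bar t)).
Proof.
have face i : (i < k.+2)%N ->
    to_bar k << del i (of_bar t) >> = << diffs k (del i (of_bar t)) >> :> chain R T k.
  by move=> ik; rewrite /to_bar linU size_del size_of_bar ?eqxx.
rewrite bd_sum linear_sum size_of_bar big_ord_recl big_ord_recr /= /boundary_basis -addrA.
have diffs_del i j : (i < k.+2)%N -> (j < k)%N -> nth 1%g (diffs k (del i (of_bar t))) j =
    ((nth 1%g (of_bar t) (bump i j))^-1 * nth 1%g (of_bar t) (bump i j.+1))%g.
  by move=> ik jk; rewrite nth_diffs // !nth_del ?size_of_bar.
congr (_ + (_ + _)).
- rewrite expr0 scale1r face //; congr << _ >>; apply: eq_tuple_nth => j jk.
  rewrite diffs_del // /bump !leq0n !add1n (of_bar_step t (i := j.+1)) // mulKg.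
  exact: (nth_mktuple1 (fun i => nth 1%g t i.+1)).
- apply: eq_bigr => i _; have ik : (i.+1 < k.+2)%N by exact: ltnW (ltn_ord i).
  rewrite linearZZ /= [bump _ _]add1n face //.
  suff -> : diffs k (del i.+1 (of_bar t)) = face_mul t i by [].
  apply: eq_tuple_nth => j jk; rewrite diffs_del //.
  rewrite -[X in _ = nth _ _ X]/(nat_of_ord (Ordinal jk)) [RHS]nth_mktuple /=.
  have jk' : (j < k.+1)%N by exact: ltnW.
  rewrite /bump ltnS -[Ordinal jk == i]/(j == i :> nat); case: (ltngtP j i) => [ji|ij|ji].
  + by rewrite add0n of_bar_step // mulKg.
  + by rewrite !add1n (of_bar_step t (i := j.+1)) // mulKg.
  + by rewrite add0n add1n (of_bar_step t (i := j.+1)) // of_bar_step // -mulgA mulKg.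
- rewrite linearZZ /= [bump _ _]add1n face //.
  suff -> : diffs k (del k.+1 (of_bar t)) = face_last t by [].
  apply: eq_tuple_nth => j jk; have jk' : (j < k.+1)%N by exact: ltnW.
  have b0 : bump k.+1 j = j by rewrite /bump ltnNge (ltnW jk).
  have b1 : bump k.+1 j.+1 = j.+1 by rewrite /bump ltnS leqNgt jk.
  rewrite diffs_del // b0 b1.
  by rewrite of_bar_step // mulKg (nth_mktuple1 (fun i => nth 1%g t i)).
Qed.

Lemma boundary_to_bar k (c : W) : boundary (to_bar k.+1 c) = to_bar k (lin bd c).
Proof.
rewrite /to_bar !lin_comp; apply: eq_lin => x /=; rewrite -/(to_bar k _).
case: eqP => [sx|sx].
  rewrite -[LHS]/(lin _ _) linU boundary_basisE diffsK // bd_map.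
  by rewrite -to_bar_coinv coinv_tr to_bar_coinv.
rewrite -[LHS]/(lin _ _) linear0 /to_bar; case: x sx => [|a x] sx.
  by rewrite bd_nil linear0.
rewrite (lin_short0 (short_bd (word_setT (a :: x)))) // => y [-> _] /=.
by case: eqP => // sk; case: sx; rewrite /= sk.
Qed.

Lemma of_bar_word S k (t : k.-tuple T) : is_subgroup S ->
  {in t, forall a, S a} -> word S k.+1 (of_bar t).
Proof.
move=> [S1 mulS _] tS; split; first exact: size_of_bar.
have foldS (s : seq T) : {in s, forall a, S a} -> S (foldmul s).
  elim/last_ind: s => [|s a IHs] sS //; rewrite foldl_rcons; apply: (mulS).
    by apply: IHs => b bs; apply: sS; rewrite mem_rcons inE bs orbT.
  by apply: sS; rewrite mem_rcons mem_head.
by move=> a /mapP[i _ ->]; apply: foldS => b /mem_take /tS.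
Qed.

Definition bar_htpy (h : seq T -> W) k : chain R T k -> chain R T k.+1 :=
  lin (fun t => to_bar k.+1 (h (of_bar t))).
HB.instance Definition _ h k := GRing.Linear.on (@bar_htpy h k).

Lemma bar_htpyP S S' n (c : nat -> nat) h k (t : k.+1.-tuple T) :
  is_subgroup S -> (k < n)%N -> {in t, forall a, S a} ->
  @null_homotopy R T S S' n c h ->
  boundary (bar_htpy h << t >>) + bar_htpy h (boundary << t >>) = << t >>.
Proof.
move=> sS kn tS [h0 hS hinv hbd].
have tW := of_bar_word sS tS; have [_ mulS invS] := sS.
rewrite [bar_htpy h << t >>]linU boundary_to_bar.
have -> : boundary << t >> = boundary_basis R t by exact: linU.
have -> : bar_htpy h (boundary_basis R t) = to_bar k.+1 (lin h (bd (of_bar t))).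
  rewrite boundary_basisE /bar_htpy [LHS]lin_comp [RHS]lin_comp.
  apply: (eq_lin_short (short_bd tW)) => x Sx.
  have [/= sx xS] := Sx; rewrite sx eqxx linU diffsK //.
  rewrite -to_bar_coinv (hinv k.+1) ?to_bar_coinv //; first exact: leq_trans kn _.
  apply: (invS); apply: xS; case: x sx {Sx} => //= a x _; exact: mem_head.
rewrite -linearD -[LHS]to_bar_coinv (hbd k.+2) // to_bar_coinv.
exact: to_bar_of_bar.
Qed.

Lemma short_bar_htpy S S' n (c : nat -> nat) h k (t : k.-tuple T) :
  is_subgroup S -> (k <= n)%N -> {in t, forall a, S a} ->
  @null_homotopy R T S S' n c h ->
  short (fun=> True) (c k.+1) (bar_htpy h << t >>).
Proof.
move=> sS kn tS [_ hS _ _]; have tW := of_bar_word sS tS.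
rewrite /bar_htpy linU -[c _]muln1.
apply: short_lin (hS k.+1 _ kn tW) _ => x _.
case: ifP => _; last exact: short0.
exact: shortU.
Qed.

End BarComparison.

(** * Acyclicity *)

Lemma homology_eq0P (U V W : zmodType) (f : {additive U -> V}) (g : {additive V -> W}) :
  is_zero (homology f g) <-> forall v, g v = 0 -> exists u, f u = v.
Proof.
split=> [H0 v gv|H x].
  have kv : v \in ker_pred g by rewrite unfold_in /ker_pred gv.
  pose z : ker g := Ker kv.
  have /eqP := etrans (H0 (\pi_(homology f g)%qT z)) (esym (H0 (\pi_(homology f g)%qT 0))).
  rewrite -Quotient.idealrBE subr0 unfold_in => /asboolP[u fu].
  by exists u.
elim/quotW: x => z; have [u fu] : exists u, f u = ker_val z.
  by apply: H; case: z => v /=; rewrite unfold_in => /eqP.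
rewrite -[RHS](raddf0 \pi_(homology f g)%qT).
apply/eqP; rewrite -Quotient.idealrBE subr0 unfold_in; apply/asboolP.
by exists u.
Qed.

Lemma short_boundary_basis (R : nzRingType) (T : groupType) (S : set T) k
    (t : k.+1.-tuple T) : is_subgroup S -> {in t, forall a, S a} ->
  short (fun t' : k.-tuple T => {in t', forall a, S a}) k.+2 (boundary_basis R t).
Proof.
move=> sS tS; have [_ mulS invS] := sS; rewrite boundary_basisE -[k.+2]muln1.
apply: short_lin (short_bd (of_bar_word sS tS)) _ => x [sx xS].
case: ifP => _; last exact: short0.
apply: shortU => a /tnthP[i ->]; rewrite tnth_mktuple; apply: (mulS).
  by apply: (invS); apply: xS; rewrite mem_nth // sx ltnW // ltnS.
by apply: xS; rewrite mem_nth // sx ltnS.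
Qed.

Lemma generated_seq_finitely_generated (T : groupType) (s : seq T) :
  finitely_generated (generated [set` s]).
Proof. by exists [set` s] => //; exact: finite_seq. Qed.

(** A cycle involves finitely many elements of the group. *)
Theorem mitotic_acyclic (T : groupType) : mitotic T -> acyclic T.
Proof.
move=> mitT [|k] // _; apply/homology_eq0P => z bz.
have [c hc] := mitotic_null_homotopy int mitT k.+1.
pose s := flatten [seq tval t | t <- dom z].
have [S' [h [_ _ _ hP]]] :=
  hc _ (generated_subgroup [set` s]) (generated_seq_finitely_generated s).
have domS t : t \in dom z -> {in t, forall a, generated [set` s] a}.
  move=> tz a ta; apply: sub_generated; apply/flattenP.
  by exists (tval t) => //; exact: map_f.
exists (bar_htpy h z).
pose F (t : k.+1.-tuple T) : chain int T k.+1 :=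
  boundary (bar_htpy h << t >>) + bar_htpy h (boundary << t >>).
rewrite -[RHS](lin_id z); transitivity (lin F z); last first.
  apply: eq_lin_dom => t /domS tS.
  exact: (bar_htpyP (generated_subgroup _) (ltnSn k) tS hP).
rewrite -[RHS]linD (lin_linear (@boundary int T k.+2 \o bar_htpy h (k := k.+1))).
rewrite (lin_linear (bar_htpy h (k := k) \o @boundary int T k.+1)).
by rewrite -[X in _ = _ + X]/(bar_htpy h (boundary z)) bz linear0 addr0.
Qed.

(** * Limits of bounded families along an ultrafilter *)

(** The images of the filter accumulate somewhere in a compact interval, and along
    an ultrafilter an accumulation point is a limit. *)
Lemma ultrafilter_limit (R : realType) (I : Type) (G : set_system I) (a : I -> R) (C : R) :
  UltraFilter G -> (forall i, `|a i| <= C) ->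
  exists l : R, `|l| <= C /\ a @ G --> l.
Proof.
move=> GU aC; have := @segment_compact R (- C) C.
move/(_ (a @ G) _ _) => [].
  by apply: (@filterE _ G) => i; rewrite /= in_itv /= -ler_norml aC.
move=> l [/=]; rewrite in_itv /= -ler_norml => lC lG; exists l; split=> //.
move=> V Vl; have [//|GV] := in_ultra_setVsetC (a @^-1` V) GU.
have [x [/= nVx Vx]] : (~` V) `&` V !=set0 by apply: lG.
by [].
Qed.

(** * Bounded acyclicity *)

Section Functionals.
Variables (R : realType) (T : groupType).

Section Linearity.
Variables (k : nat) (f : chain R T k -> R).
Hypothesis flin : forall (a : R) (c c' : chain R T k), f (a *: c + c') = a * f c + f c'.

Definition functional : chain R T k -> R^o := f.
HB.instance Definition _ := GRing.isLinear.Build R (chain R T k) R^o *:%R functional flin.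

Lemma functional_lin (K : choiceType) (g : K -> chain R T k) (c : {freeg K / R}) :
  f (lin g c) = lin (fun x => f (g x) : R^o) c.
Proof. exact: (lin_comp functional). Qed.

End Linearity.

Lemma l1norm_short k P n (c : {freeg (k.-tuple T) / R}) :
  short P n c -> l1norm (c : chain R T k) <= n%:R.
Proof.
move=> [s [sn _ ->]]; apply: (le_trans (l1norm_sum _ _)).
under eq_bigr do rewrite l1normZ l1norm_basis normrX normrN1 expr1n mulr1.
by rewrite big_const_seq count_predT iter_addr_0 ler_nat.
Qed.

Lemma lin_bounded k (u : k.-tuple T -> R) (C : R) (c : chain R T k) :
  (forall t, `|u t| <= C) ->
  `|lin (u : _ -> R^o) (c : {freeg (k.-tuple T) / R})| <= C * l1norm c.
Proof.
move=> uC; rewrite linE; apply: (le_trans (ler_norm_sum _ _ _)).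
rewrite /l1norm mulr_sumr; apply: ler_sum => t _.
by rewrite normrZ mulrC ler_wpM2r.
Qed.

Lemma cvg_lin (I : Type) (G : set_system I) (K : choiceType) (a : I -> K -> R)
    (l : K -> R) (c : {freeg K / R}) :
  Filter G -> (forall x, a i x @[i --> G] --> l x) ->
  (lin (a i : K -> R^o) c : R) @[i --> G] --> (lin (l : K -> R^o) c : R).
Proof.
move=> FG al.
have -> : (fun i => lin (a i : K -> R^o) c : R) =
    (fun i => \sum_(z <- dom c) coeff z c * a i z).
  by apply/funext => i; rewrite linE.
rewrite linE; elim: (dom c) => [|x s IHs].
  rewrite big_nil; have -> : (fun i => \sum_(z <- [::]) coeff z c * a i z) = fun=> 0.
    by apply/funext => i; rewrite big_nil.
  exact: cvg_cst.
rewrite big_cons; have -> : (fun i => \sum_(z <- x :: s) coeff z c * a i z) =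
    (fun i => coeff x c * a i x + \sum_(z <- s) coeff z c * a i z).
  by apply/funext => i; rewrite big_cons.
by apply: cvgD => //; apply: cvgMl_tmp; exact: al.
Qed.

End Functionals.

(** On a finitely generated subgroup, composing [f] with the homotopy gives a
    primitive of [f]. These primitives need not agree on common subgroups, but
    their bounds do, so they have a limit along an ultrafilter of finite sets of
    generators that eventually contain any given element. *)
Lemma mitotic_bounded_primitive (R : realType) (T : groupType) k
    (f : bounded_cochain R T k.+1) : mitotic T ->
  (forall c : chain R T k.+2, f (boundary c) = 0) ->
  exists u : bounded_cochain R T k, forall c : chain R T k.+1, u (boundary c) = f c.
Proof.
move=> mitT fcocycle.
have /asboolP[flin [C fC]] : cochain_val f \in @bounded_functional R T k.+1 by exact: valP.
have [c hc] := mitotic_null_homotopy R mitT k.+1.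
have {hc} hc (s : seq T) : exists h : seq T -> {freeg (seq T) / R}, exists S',
    null_homotopy (generated [set` s]) S' k.+1 c h.
  have [S' [h [_ _ _ hP]]] :=
    hc _ (generated_subgroup [set` s]) (generated_seq_finitely_generated s).
  by exists h, S'.
have [h hP] := choice hc.
pose B := `|C| * (c k.+1)%:R.
pose a (s : seq T) (t : k.-tuple T) : R :=
  if `[< {in t, forall x, generated [set` s] x} >] then f (bar_htpy (h s) << t >>) else 0.
have aB s t : `|a s t| <= B.
  rewrite /a; case: asboolP => [tS|_]; last by rewrite normr0 mulr_ge0.
  apply: (le_trans (fC _)); have [S' hS'] := hP s.
  have := l1norm_short (short_bar_htpy (generated_subgroup _) (leqnSn k) tS hS').
  move=> le_c; apply: (@le_trans _ _ (`|C| * l1norm (bar_htpy (h s) << t >>))).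
    by rewrite ler_wpM2r ?l1norm_ge0 // ler_norm.
  by rewrite /B ler_wpM2l.
(* Finite sets of generators, directed by inclusion. *)
pose F : set_system (seq T) :=
  filter_from setT (fun s0 : seq T => [set s : seq T | {subset s0 <= s}]).
have FF : ProperFilter F.
  apply: filter_from_proper; last by move=> s _; exists s => x.
  apply: filter_from_filter; first by exists [::].
  move=> s s' _ _; exists (s ++ s') => // s'' /= sub.
  by split=> x xs; apply: sub; rewrite mem_cat xs ?orbT.
have [G [GU FG]] := ultraFilterLemma FF.
have alim t : exists l : R, `|l| <= B /\ a s t @[s --> G] --> l.
  by apply: ultrafilter_limit => s; exact: aB.
have [l lP] := choice alim.
pose u0 : chain R T k -> R := lin (l : _ -> R^o).
have bu0 : u0 \in @bounded_functional R T k.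
  apply/asboolP; split=> [x y z|]; first by rewrite /u0 linearP.
  by exists B => x; apply: lin_bounded => t; case: (lP t).
exists (BoundedCochain bu0) => z /=.
suff fE t : u0 (boundary_basis R t) = f << t >>.
  rewrite -[in RHS](lin_id z) (functional_lin flin) /u0.
  rewrite -[fglift _ z]/(lin (@boundary_basis R T k) z) lin_comp; exact: eq_lin.
have lim_a : (lin (a s : _ -> R^o) (boundary_basis R t) : R) @[s --> G] -->
    (lin (l : _ -> R^o) (boundary_basis R t) : R).
  by apply: cvg_lin => x; case: (lP x).
(* Once [s] contains the entries of [t], the family is constant. *)
have lim_f : (lin (a s : _ -> R^o) (boundary_basis R t) : R) @[s --> G] --> f << t >>.
  apply: cvg_near_cst; apply: FG; exists (tval t) => // s /= ts.
  have tS : {in t, forall x, generated [set` s] x}.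
    by move=> x /ts xs; exact: sub_generated.
  have [S' hS'] := hP s.
  rewrite -[in RHS](bar_htpyP (generated_subgroup _) (ltnSn k) tS hS').
  rewrite -[X in f (X + _)]scale1r flin fcocycle mulr0 add0r.
  have -> : boundary << t >> = boundary_basis R t by exact: linU.
  rewrite -[X in bar_htpy _ X](lin_id) [X in f X]lin_comp (functional_lin flin).
  apply: (eq_lin_short (short_boundary_basis R (generated_subgroup _) tS)) => t' t'S /=.
  by rewrite /a; case: asboolP.
exact: (cvg_unique _ lim_a lim_f).
Qed.

(** The class of the functional that sums the coefficients is not zero. *)
Lemma bounded_cohomology0_neq0 (R : realType) (T : groupType) :
  ~ is_zero (bounded_cohomology R T 0).
Proof.
move/homology_eq0P => H.
pose e : chain R T 0 -> R := lin (fun=> 1 : R^o).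
have be : e \in @bounded_functional R T 0.
  apply/asboolP; split=> [a c c'|]; first by rewrite /e linearP.
  by exists 1 => c; apply: lin_bounded => t; rewrite normr1.
have [|u ue] := H (BoundedCochain be).
  apply: val_inj; apply/funext => c /=.
  rewrite -[fglift _ c]/(lin (@boundary_basis R T 0) c) /e lin_comp.
  rewrite -[RHS](lin0 _ c); apply: eq_lin => t /=.
  rewrite /boundary_basis big_ord0 addr0 expr1 scaleN1r linearB /= !linU.
  exact: subrr.
have := congr1 (fun f : bounded_cochain R T 0 => f << [tuple] >>) ue.
rewrite /= /e linU => u1; have := oner_neq0 R; rewrite -u1.
have /asboolP[ulin _] : cochain_val u \in @bounded_functional R T 0 by exact: valP.
have := ulin 1 0 0; rewrite scale1r addr0 mul1r => /eqP.
by rewrite -subr_eq0 opprD addNKr oppr_eq0 => /eqP ->; rewrite eqxx.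
Qed.

Theorem mitotic_bcd (R : realType) (T : groupType) : mitotic T -> bcd R T = 0%E.
Proof.
move=> mitT; rewrite /bcd.
have -> : [set n | ~ is_zero (bounded_cohomology R T n)] = [set 0%N].
  apply/seteqP; split=> [[|k] //|n ->]; last exact: bounded_cohomology0_neq0.
  case; apply/homology_eq0P => f /(congr1 val) /= f0.
  have [|u uf] := @mitotic_bounded_primitive R T k f mitT.
    by move=> c; have := congr1 (@^~ c) f0.
  by exists u; apply: val_inj; apply/funext => c; exact: uf.
by rewrite image_set1 [LHS]supremum1.
Qed.

(** * Unrestricted permutational wreath products *)

Section Wreath.
Variables (G : groupType) (X : Type).

(** The permutations of [G * X] of the form [(g, x) -> (wlab x * g, wperm x)]. *)
Record wreath := Wreath {
  wlab : X -> G;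
  wperm : X -> X;
  wpermV : X -> X;
  wpermK : cancel wperm wpermV;
  wpermVK : cancel wpermV wperm
}.

HB.instance Definition _ := gen_eqMixin wreath.
HB.instance Definition _ := gen_choiceMixin wreath.

Lemma wreath_ext (u w : wreath) : wlab u =1 wlab w -> wperm u =1 wperm w -> u = w.
Proof.
case: u w => [c p q pK qK] [c' p' q' pK' qK'] /= /funext cc' /funext pp'.
subst c' p'.
have qq' : q = q' by apply/funext => x; rewrite -{1}[x]qK' pK.
subst q'; congr Wreath; exact: Prop_irrelevance.
Qed.

Definition wmul (u w : wreath) : wreath :=
  @Wreath (fun x => wlab u (wperm w x) * wlab w x)%g
    (wperm u \o wperm w) (wpermV w \o wpermV u)
    (can_comp (@wpermK u) (@wpermK w)) (can_comp (@wpermVK w) (@wpermVK u)).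

Definition wone : wreath :=
  @Wreath (fun=> 1%g) id id (fun=> erefl) (fun=> erefl).

Definition winv (w : wreath) : wreath :=
  @Wreath (fun x => (wlab w (wpermV w x))^-1)%g (wpermV w) (wperm w)
    (@wpermVK w) (@wpermK w).

Lemma wmulA : associative wmul.
Proof. by move=> u v w; apply: wreath_ext => x //=; rewrite mulgA. Qed.

Lemma wmul1 : left_id wone wmul.
Proof. by move=> w; apply: wreath_ext => x //=; rewrite mul1g. Qed.

Lemma wmulr1 : right_id wone wmul.
Proof. by move=> w; apply: wreath_ext => x //=; rewrite mulg1. Qed.

Lemma wmulV : left_inverse wone winv wmul.
Proof.
move=> w; apply: wreath_ext => x /=; first by rewrite wpermK mulVg.
exact: wpermK.
Qed.

Lemma wmulrV : right_inverse wone winv wmul.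
Proof.
move=> w; apply: wreath_ext => x /=; first by rewrite mulgV.
exact: wpermVK.
Qed.

HB.instance Definition _ := isGroup.Build wreath wmulA wmul1 wmulr1 wmulV wmulrV.

End Wreath.

(** * Three copies of the natural numbers *)

Definition slot : Type := (nat + nat + nat)%type.

Definition in_first (i : slot) : bool := if i is inl (inl _) then true else false.
Definition split_nat n : nat + nat := if odd n then inr n./2 else inl n./2.
Definition join_nat (z : nat + nat) : nat :=
  match z with inl n => n.*2 | inr n => n.*2.+1 end.

Lemma split_natK : cancel split_nat join_nat.
Proof.
move=> n; rewrite /split_nat -[RHS]odd_double_half; case: (odd n) => //=.
Qed.

Lemma join_natK : cancel join_nat split_nat.
Proof.
by case=> n; rewrite /split_nat /= odd_double /= ?doubleK ?uphalf_double.
Qed.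

Definition swap (i : slot) : slot :=
  match i with
  | inl (inl n) => inl (inr n)
  | inl (inr n) => inl (inl n)
  | inr n => inr n
  end.

Lemma swapK : involutive swap.
Proof. by case=> [[]|]. Qed.

(** The first copy goes onto the first two, and the other two onto the third. *)
Definition spread (i : slot) : slot :=
  match i with
  | inl (inl n) => inl (split_nat n)
  | inl (inr n) => inr (join_nat (inl n))
  | inr n => inr (join_nat (inr n))
  end.

Definition gather (i : slot) : slot :=
  match i with
  | inl z => inl (inl (join_nat z))
  | inr n => match split_nat n with inl m => inl (inr m) | inr m => inr m end
  end.

Lemma spreadK : cancel spread gather.
Proof.
case=> [[n|n]|n]; rewrite /= ?split_natK //.
  by rewrite -[n.*2]/(join_nat (inl n)) join_natK.
by rewrite -[n.*2.+1]/(join_nat (inr n)) join_natK.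
Qed.

Lemma gatherK : cancel gather spread.
Proof.
case=> [z|n] /=; first by rewrite join_natK.
by rewrite -[in RHS](split_natK n); case: (split_nat n).
Qed.

(** * The group M(G) *)

Definition address := nat -> slot.

Section Address.
Implicit Types (x y t : address) (n : nat) (i : slot).

Definition tail n x : Prop := forall j, (n <= j)%N -> in_first (x j).

Definition glue n x t : address := fun j => if (j < n)%N then x j else t j.

Definition upd n i x : address := fun j => if j == n then i else x j.

Lemma tailS n x : tail n x <-> in_first (x n) /\ tail n.+1 x.
Proof.
split=> [xn|[xn xn1] j]; last by rewrite leq_eqVlt => /orP[/eqP <-|/xn1].
by split=> [|j nj]; apply: xn => //; exact: ltnW.
Qed.

Lemma tail_upd n i x : tail n.+1 (upd n i x) <-> tail n.+1 x.
Proof.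
by split=> xn j nj; have := xn j nj; rewrite /upd; case: eqP nj => // ->; rewrite ltnn.
Qed.

Lemma upd_id n i x : x n = i -> upd n i x = x.
Proof. by move=> <-; apply/funext => j; rewrite /upd; case: eqP => // ->. Qed.

Lemma upd_upd n i j x : upd n i (upd n j x) = upd n i x.
Proof. by apply/funext => k; rewrite /upd; case: eqP. Qed.

Lemma upd_at n i x : upd n i x n = i.
Proof. by rewrite /upd eqxx. Qed.

Lemma glue_id n x : glue n x x = x.
Proof. by apply/funext => j; rewrite /glue if_same. Qed.

Lemma tail_glue n x t : tail n (glue n x t) <-> tail n t.
Proof. by split=> tn j nj; have := tn j nj; rewrite /glue ltnNge nj. Qed.

(** The action on one coordinate is restricted to where the later ones lie in the
    first copy, so that later generators can move it elsewhere. *)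
Definition at_coord (p : slot -> slot) n x : address :=
  if `[< tail n.+1 x >] then upd n (p (x n)) x else x.

Lemma at_coordK p p' n : cancel p p' -> cancel (at_coord p n) (at_coord p' n).
Proof.
move=> pK x; rewrite /at_coord; case: (asboolP (tail n.+1 x)) => xn; last first.
  by case: asboolP.
have xn' : tail n.+1 (upd n (p (x n)) x) by apply/tail_upd.
by rewrite (asboolT xn') upd_at pK upd_upd upd_id.
Qed.

End Address.

Section MitoticExtension.
Variable G : groupType.
Implicit Types (u w : wreath G address) (x y t : address) (n : nat) (g : G).

Definition base g : wreath G address :=
  @Wreath G address (fun x => if `[< tail 0 x >] then g else 1%g) id id
    (fun=> erefl) (fun=> erefl).

Definition coord_perm q qV (qK : cancel q qV) (qVK : cancel qV q) n : wreath G address :=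
  @Wreath G address (fun=> 1%g) (at_coord q n) (at_coord qV n)
    (at_coordK n qK) (at_coordK n qVK).

Definition swap_at := coord_perm swapK swapK.
Definition spread_at := coord_perm spreadK gatherK.

Definition gens : set (wreath G address) :=
  [set w | (exists g, w = base g) \/ exists n, w = swap_at n \/ w = spread_at n].

Definition mext_pred : {pred wreath G address} := fun w => `[< generated gens w >].

Lemma mext_group_closed : group_closed mext_pred.
Proof.
have [g1 gM gV] := generated_subgroup gens.
split=> [|u w]; rewrite !unfold_in; first exact/asboolP.
by move=> /asboolP uG /asboolP wG; apply/asboolP; apply: (gM) => //; exact: (gV).
Qed.

Record mext := MExt { mext_val :> wreath G address; _ : mext_val \in mext_pred }.

HB.instance Definition _ := [isSub for mext_val].
HB.instance Definition _ := [Choice of mext by <:].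
HB.instance Definition _ :=
  SubChoice_isSubGroup.Build (wreath G address) mext_pred mext mext_group_closed.

(** Elements of level [n] only see an address whose coordinates from [n] on lie
    in the first copy, and then only through its coordinates before [n]. *)
Definition level n : set (wreath G address) := fun w =>
  (forall x, ~ tail n x -> wperm w x = x /\ wlab w x = 1%g) /\
  (forall x t, tail n x -> tail n t ->
     wperm w (glue n x t) = glue n (wperm w x) t /\ wlab w (glue n x t) = wlab w x).

Lemma level_keeps n w x j : level n w -> (n <= j)%N -> wperm w x j = x j.
Proof.
move=> [w0 w1] nj; have [xn|xn] := pselect (tail n x); last by rewrite (w0 _ xn).1.
by have [+ _] := w1 _ _ xn xn; rewrite glue_id => ->; rewrite /glue ltnNge nj.
Qed.

Lemma level_tail n w x : level n w -> tail n (wperm w x) <-> tail n x.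
Proof.
by move=> lw; split=> xn j nj; have := xn j nj; rewrite (level_keeps _ lw).
Qed.

Lemma level_subgroup n : is_subgroup (level n).
Proof.
split=> [|u w [u0 u1] lw|w lw]; first by split.
- have [w0 w1] := lw; split=> [x xn|x t xn tn] /=.
    have [-> ->] := w0 _ xn; rewrite mulg1; exact: u0.
  have [-> ->] := w1 _ _ xn tn.
  have xn' : tail n (wperm w x) by apply/level_tail.
  by have [-> ->] := u1 _ _ xn' tn.
- have [w0 w1] := lw; split=> [x xn|x t xn tn] /=.
    have [wx lx] := w0 _ xn.
    have -> : wpermV w x = x by rewrite -{1}wx wpermK.
    by rewrite lx invg1.
  have xn' : tail n (wpermV w x) by apply/(level_tail _ lw); rewrite wpermVK.
  have [wx lx] := w1 _ _ xn' tn; rewrite wpermVK in wx.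
  have -> : wpermV w (glue n x t) = glue n (wpermV w x) t by rewrite -wx wpermK.
  by rewrite lx.
Qed.

Lemma level_succ n : level n `<=` level n.+1.
Proof.
move=> w lw; have [w0 w1] := lw; split=> [x xn|x t xn tn].
  by apply: w0 => /tailS[].
have [xn0|xn0] := boolP (in_first (x n)); last first.
  have nx : ~ tail n x by move=> /tailS[]; rewrite (negbTE xn0).
  have nxt : ~ tail n (glue n.+1 x t).
    by move=> /tailS[]; rewrite /glue ltnSn (negbTE xn0).
  by have [-> ->] := w0 _ nx; have [-> ->] := w0 _ nxt.
have tx : tail n x by apply/tailS.
have gE y : y n = x n -> glue n.+1 y t = glue n y (upd n (x n) t).
  move=> yx; apply/funext => j; rewrite /glue /upd ltnS leq_eqVlt.
  by case: eqP => [->|] //=; rewrite ltnn.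
have tt : tail n (upd n (x n) t) by apply/tailS; rewrite upd_at; split=> //; apply/tail_upd.
rewrite !gE // ?(level_keeps x lw) //; exact: w1.
Qed.

Lemma level_le n m : (n <= m)%N -> level n `<=` level m.
Proof.
elim: m => [|m IHm]; first by rewrite leqn0 => /eqP ->.
rewrite leq_eqVlt => /orP[/eqP -> //|]; rewrite ltnS => /IHm nm.
by apply: (subset_trans nm); exact: level_succ.
Qed.

Lemma level_base g : level 0 (base g).
Proof.
split=> [x x0|x t x0 t0] /=; first by rewrite asboolF.
have -> : glue 0 x t = t by apply/funext.
by rewrite !asboolT.
Qed.

Lemma level_coord_perm q qV (qK : cancel q qV) (qVK : cancel qV q) n :
  level n.+1 (coord_perm qK qVK n).
Proof.
split=> [x xn|x t xn tn] /=; first by rewrite /at_coord asboolF.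
split=> //; rewrite /at_coord (asboolT xn) asboolT; last exact/tail_glue.
apply/funext => j; rewrite /upd /glue ltnSn; case: eqP => // ->.
by rewrite ltnSn.
Qed.

Lemma mext_level (w : mext) : exists n, level n (mext_val w).
Proof.
case: w => w /= /asboolP.
have subL : is_subgroup [set v | exists n, level n v].
  split=> [|u v [n un] [m vm]|v [n vn]].
  - by exists 0%N; have [] := level_subgroup 0.
  - exists (maxn n m); have [_ M _] := level_subgroup (maxn n m).
    by apply: (M); [apply: level_le un|apply: level_le vm]; rewrite ?leq_maxl ?leq_maxr.
  - by exists n; have [_ _ V] := level_subgroup n; exact: (V).
apply: (generated_min subL) => v [[g ->]|[n [->|->]]].
- by exists 0%N; exact: level_base.
- by exists n.+1; exact: level_coord_perm.
- by exists n.+1; exact: level_coord_perm.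
Qed.

Let i0 : slot := inl (inl 0%N).

Definition placed n (P : pred slot) x : bool := `[< tail n.+1 x >] && P (x n).

(** Permutation and labels of the element [w] of level [n], made to act where
    coordinate [n] satisfies [P] rather than where it is in the first copy. *)
Definition place_perm w n P x : address :=
  if placed n P x then upd n (x n) (wperm w (upd n i0 x)) else x.

Definition place_lab w n P x : G :=
  if placed n P x then wlab w (upd n i0 x) else 1%g.

Lemma level_upd w n x i : level n w -> tail n.+1 x -> in_first i ->
  wperm w (upd n i x) = upd n i (wperm w (upd n i0 x)) /\
  wlab w (upd n i x) = wlab w (upd n i0 x).
Proof.
move=> lw xn i1; have [_ w1] := lw.
have t0 : tail n (upd n i0 x) by apply/tailS; rewrite upd_at; split=> //; apply/tail_upd.
have ti : tail n (upd n i x) by apply/tailS; rewrite upd_at; split=> //; apply/tail_upd.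
have gE y : (forall j, (n <= j)%N -> y j = upd n i0 x j) ->
    glue n y (upd n i x) = upd n i y.
  move=> yx; apply/funext => j; rewrite /glue /upd; case: ltnP => nj.
    by case: eqP => // jn; rewrite jn ltnn in nj.
  by case: eqP => // jn; rewrite yx // /upd; case: eqP.
have := w1 _ _ t0 ti; rewrite gE // upd_upd gE // => j nj.
exact: level_keeps lw nj.
Qed.

Lemma placeE w n x : level n w ->
  wperm w x = place_perm w n in_first x /\ wlab w x = place_lab w n in_first x.
Proof.
move=> lw; have [w0 _] := lw; rewrite /place_perm /place_lab /placed.
case: asboolP => xn /=; last by apply: w0 => /tailS[].
case: ifP => x1; last by apply: w0 => /tailS[]; rewrite x1.
by have := level_upd lw xn x1; rewrite upd_id.
Qed.

(** Conjugation by a permutation of coordinate [n] moves the action of [w] along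
    that permutation, as [w] treats all values in the first copy alike. *)
Lemma lconj_place q qV (qK : cancel q qV) (qVK : cancel qV q) w n x : level n w ->
  wperm (lconj w (coord_perm qK qVK n)) x = place_perm w n (in_first \o qV) x /\
  wlab (lconj w (coord_perm qK qVK n)) x = place_lab w n (in_first \o qV) x.
Proof.
move=> lw; have [w0 _] := lw; rewrite /= invg1 mulg1 mul1g.
rewrite /place_perm /place_lab /placed [at_coord qV n x]/at_coord.
case: asboolP => xn /=; last first.
  have [-> ->] : wperm w x = x /\ wlab w x = 1%g by apply: w0 => /tailS[].
  by rewrite /at_coord asboolF.
have xn' i y : tail n.+1 y -> tail n.+1 (upd n i y) by move=> ?; apply/tail_upd.
case: ifP => x1; last first.
  have [-> ->] : wperm w (upd n (qV (x n)) x) = upd n (qV (x n)) x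
      /\ wlab w (upd n (qV (x n)) x) = 1%g.
    by apply: w0 => /tailS[]; rewrite upd_at x1.
  by rewrite /at_coord (asboolT (xn' (qV (x n)) _ xn)) upd_at qVK upd_upd upd_id.
have [-> ->] := level_upd lw xn x1; split=> //.
have xnw : tail n.+1 (upd n (qV (x n)) (wperm w (upd n i0 x))).
  apply: (xn') => j nj.
  by rewrite (level_keeps _ lw) ?(ltnW nj) //; exact: (xn' i0 _ xn).
by rewrite /at_coord (asboolT xnw) upd_at qVK upd_upd.
Qed.

Lemma placed_place w n P Q x : level n w ->
  placed n Q (place_perm w n P x) = placed n Q x.
Proof.
move=> lw; rewrite /place_perm; case: ifP => // /andP[/asboolP xn _].
rewrite /placed upd_at; congr (_ && _); apply/asboolP/asboolP => // _.
apply/tail_upd => j nj; rewrite (level_keeps _ lw) ?(ltnW nj) //.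
by have /tail_upd := xn; exact.
Qed.

Lemma place_place w w' n P Q x : level n w ->
  place_perm w' n Q (place_perm w n P x) =
    (if placed n Q x
     then upd n (place_perm w n P x n) (wperm w' (upd n i0 (place_perm w n P x)))
     else place_perm w n P x) /\
  place_lab w' n Q (place_perm w n P x) =
    (if placed n Q x then wlab w' (upd n i0 (place_perm w n P x)) else 1%g).
Proof.
by move=> lw; rewrite {1}[place_perm w' _ _ _]/place_perm /place_lab !placed_place.
Qed.

Lemma in_first_gather i : in_first (gather i) = in_first i || in_first (swap i).
Proof. by case: i => [[m|m]|m] //=; case: (split_nat m). Qed.

Lemma swap_disjoint i : in_first i && in_first (swap i) = false.
Proof. by case: i => [[]|]. Qed.

Lemma placed_spread n x :
  placed n (in_first \o gather) x = placed n in_first x || placed n (in_first \o swap) x.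
Proof. by rewrite /placed /= in_first_gather andb_orr. Qed.

Lemma placed_disjoint n x : placed n in_first x && placed n (in_first \o swap) x = false.
Proof. by rewrite /placed andbACA swap_disjoint andbF. Qed.

Lemma lconj_spread_at w n : level n w ->
  lconj w (spread_at n) = (w * lconj w (swap_at n))%g.
Proof.
move=> lw; have pu x := lconj_place spreadK gatherK x lw.
have pv x := lconj_place swapK swapK x lw.
rewrite -/(spread_at n) in pu; rewrite -/(swap_at n) in pv.
move: (lconj w (spread_at n)) pu (lconj w (swap_at n)) pv => u pu v pv.
have disj := placed_disjoint n.
apply: wreath_ext => x /=; have [pux lux] := pu x; have [pvx lvx] := pv x;
  have [py ly] := placeE (place_perm w n (in_first \o swap) x) lw;
  have [ppy lly] := place_place w (in_first \o swap) in_first x lw;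
  rewrite ?lux ?pux ?lvx pvx ?py ?ly ?ppy ?lly /place_lab /place_perm placed_spread;
  have := disj x; case: (placed n in_first x); case: (placed n (in_first \o swap) x) => //=;
  by rewrite ?mulg1 ?mul1g.
Qed.

Lemma lconj_swap_at_commute w w' n : level n w -> level n w' ->
  [~ w', lconj w (swap_at n)]%g = 1%g.
Proof.
move=> lw lw'; apply/eqP/commgP.
have pv x := lconj_place swapK swapK x lw; rewrite -/(swap_at n) in pv.
move: (lconj w (swap_at n)) pv => v pv.
have disj := placed_disjoint n.
apply: wreath_ext => x /=; have [pvx lvx] := pv x; have [pwx lwx] := placeE x lw';
  have [pvw lvw] := pv (place_perm w' n in_first x);
  have [pwv lwv] := placeE (place_perm w n (in_first \o swap) x) lw';
  have [ppy lly] := place_place w' (in_first \o swap) in_first x lw;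
  have [ppz llz] := place_place w in_first (in_first \o swap) x lw';
  rewrite ?lvx ?lwx pvx pwx ?lvw ?lwv ?pvw ?pwv ?ppy ?ppz ?lly ?llz /place_lab /place_perm;
  have := disj x; case: (placed n in_first x); case: (placed n (in_first \o swap) x) => //=;
  by rewrite ?mulg1 ?mul1g.
Qed.

End MitoticExtension.

Lemma max_level (G : groupType) (s : seq (mext G)) :
  exists n, forall w, w \in s -> level n (mext_val w).
Proof.
elim: s => [|w s [n IHs]]; first by exists 0%N.
have [m wm] := mext_level w; exists (maxn n m) => v; rewrite inE => /orP[/eqP ->|/IHs vn].
  exact: level_le (leq_maxr _ _) _ wm.
exact: level_le (leq_maxl _ _) _ vn.
Qed.

(** Finitely many elements have a common level [n]; take the generators at [n]. *)
Theorem mext_mitotic (G : groupType) : mitotic (mext G).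
Proof.
move=> H sH [A /finite_seqP[r ->] HE].
have [n rn] := max_level r.
have Hn (w : mext G) : H w -> level n (mext_val w).
  have [L1 LM LV] := @level_subgroup G n.
  have sL : is_subgroup [set w : mext G | level n (mext_val w)].
    by split=> [|u v lu lv|v lv] /=; [|exact: LM|exact: LV].
  by rewrite HE; apply: (generated_min sL).
have gen_in (w : wreath G address) : gens w -> w \in @mext_pred G.
  by move=> gw; rewrite unfold_in; apply/asboolP; exact: sub_generated.
pose s : mext G := MExt (gen_in (swap_at G n) (or_intror (ex_intro _ n (or_introl erefl)))).
pose d : mext G := MExt (gen_in (spread_at G n) (or_intror (ex_intro _ n (or_intror erefl)))).
have HM : H `<=` generated (H `|` [set s; d]).
  by move=> w Hw; apply: sub_generated; left.
exists (generated (H `|` [set s; d])); split=> //; first exact: generated_subgroup.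
split=> //; first exact: generated_subgroup.
exists s, d; split=> //.
- by split; apply: sub_generated; right; [left|right].
- by move=> w /Hn lw; apply: val_inj; exact: lconj_spread_at.
- by move=> w w' /Hn lw /Hn lw'; apply: val_inj; exact: lconj_swap_at_commute.
Qed.

(** * Functoriality *)

Section Functoriality.
Variables (G H : groupType) (f : {multiplicative G -> H}).

Lemma multiplicative1 : f 1%g = 1%g.
Proof. by apply: (mulgI (f 1)%g); rewrite -gmulfM !mulg1. Qed.

Definition wmap (w : wreath G address) : wreath H address :=
  @Wreath H address (f \o wlab w) (wperm w) (wpermV w) (@wpermK _ _ w) (@wpermVK _ _ w).

Lemma wmapM u w : wmap (u * w)%g = (wmap u * wmap w)%g.
Proof. by apply: wreath_ext => x //=; rewrite gmulfM. Qed.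

Lemma wmap1 : wmap 1%g = 1%g.
Proof. by apply: wreath_ext => x //=; rewrite multiplicative1. Qed.

Lemma wmap_base g : wmap (base g) = base (f g).
Proof. by apply: wreath_ext => x //=; case: ifP => // _; rewrite multiplicative1. Qed.

Lemma wmap_coord_perm q qV (qK : cancel q qV) (qVK : cancel qV q) n :
  wmap (coord_perm G qK qVK n) = coord_perm H qK qVK n.
Proof. by apply: wreath_ext => x //=; rewrite multiplicative1. Qed.

Lemma wmap_mext (w : mext G) : wmap (mext_val w) \in @mext_pred H.
Proof.
rewrite unfold_in; apply/asboolP.
have [g1 gM gV] := @generated_subgroup _ (@gens H).
have sub : is_subgroup [set w : wreath G address | generated (@gens H) (wmap w)].
  split=> [|u v gu gv|v gv] /=; first by rewrite wmap1.
    by rewrite wmapM; exact: gM.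
  have -> : wmap v^-1%g = (wmap v)^-1%g; last exact: gV.
  by apply: (mulgI (wmap v)); rewrite -wmapM !mulgV wmap1.
case: w => w /= /asboolP; apply: (generated_min sub) => v gv /=; apply: sub_generated.
case: gv => [[g ->]|[n [->|->]]].
- by left; exists (f g); exact: wmap_base.
- by right; exists n; left; exact: wmap_coord_perm.
- by right; exists n; right; exact: wmap_coord_perm.
Qed.

Definition mext_map (w : mext G) : mext H := MExt (wmap_mext w).

Lemma mext_mapM : {morph mext_map : u w / (u * w)%g}.
Proof. by move=> u w; apply: val_inj; exact: wmapM. Qed.

HB.instance Definition _ := isMultiplicative.Build (mext G) (mext H) mext_map mext_mapM.

End Functoriality.

Lemma mext_map_id (G : groupType) :
  mext_map (idfun : {multiplicative G -> G}) =1 idfun.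
Proof. by move=> w; apply: val_inj; apply: wreath_ext. Qed.

Lemma mext_map_comp (G H K : groupType) (f : {multiplicative G -> H})
    (g : {multiplicative H -> K}) :
  mext_map (g \o f : {multiplicative G -> K}) =1 mext_map g \o mext_map f.
Proof. by move=> w; apply: val_inj; apply: wreath_ext. Qed.

Definition mext_functor : group_functor :=
  @GroupFunctor mext (fun G H f => mext_map f) mext_map_id mext_map_comp.

Section Unit.
Variable G : groupType.

Lemma base_mext (g : G) : base g \in @mext_pred G.
Proof. by rewrite unfold_in; apply/asboolP; apply: sub_generated; left; exists g. Qed.

Definition mext_unit (g : G) : mext G := MExt (base_mext g).

Lemma mext_unitM : {morph mext_unit : g h / (g * h)%g}.
Proof.
move=> g h; apply: val_inj; apply: wreath_ext => x //=.
by case: ifP => // _; rewrite mulg1.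
Qed.

HB.instance Definition _ := isMultiplicative.Build G (mext G) mext_unit mext_unitM.

Lemma mext_unit_inj : injective mext_unit.
Proof.
move=> g h /(congr1 (fun w : mext G => wlab (mext_val w) (fun=> inl (inl 0%N)))) /=.
by rewrite !asboolT.
Qed.

End Unit.

Lemma mext_unit_natural (G H : groupType) (f : {multiplicative G -> H}) :
  @mext_unit H \o f =1 mext_map f \o @mext_unit G.
Proof. by move=> g; apply: val_inj; rewrite /= wmap_base. Qed.

Definition mext_natural : natural_transformation id_functor mext_functor :=
  @NaturalTransformation id_functor mext_functor (fun G => @mext_unit G)
    mext_unit_natural.

(** * Words over an infinite set *)

Definition injects (T : Type) (A B : set T) : Prop :=
  exists2 j : T -> T, forall a, A a -> B (j a) &
    forall a a', A a -> A a' -> j a = j a' -> a = a'.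

(** A maximal partial injection from [A] to [B] exhausts [A] or [B]. *)
Lemma injects_total (T : Type) (A B : set T) : injects A B \/ injects B A.
Proof.
pose P (R : set (T * T)) := [/\ forall a b, R (a, b) -> A a /\ B b,
  forall a b b', R (a, b) -> R (a, b') -> b = b' &
  forall a a' b, R (a, b) -> R (a', b) -> a = a'].
have [F FP Ftot|R [[RAB Rfun Rinj] Rmax]] := @Zorn_bigcup _ P.
  have pair z w X Y : F X -> F Y -> X z -> Y w -> exists Z, [/\ F Z, Z z & Z w].
    move=> FX FY Xz Yw; have [XY|YX] := Ftot _ _ FX FY.
      by exists Y; split=> //; exact: XY.
    by exists X; split=> //; exact: YX.
  split=> [a b [X FX Xab]|a b b' [X FX Xab] [Y FY Yab']|a a' b [X FX Xab] [Y FY Yab']].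
  - by have [+ _ _] := FP _ FX; apply; exact: Xab.
  - have [Z [FZ Zab Zab']] := pair _ _ _ _ FX FY Xab Yab'.
    by have [_ f _] := FP _ FZ; exact: f Zab Zab'.
  - have [Z [FZ Zab Zab']] := pair _ _ _ _ FX FY Xab Yab'.
    by have [_ _ f] := FP _ FZ; exact: f Zab Zab'.
have [totA|] := pselect (forall a, A a -> exists b, R (a, b)).
  left; have /choice[j jP] : forall a, exists b, A a -> R (a, b).
    move=> a; have [Aa|nAa] := pselect (A a); last by exists a.
    by have [b Rab] := totA _ Aa; exists b.
  exists j => [a Aa|a a' Aa Aa' jj]; first by have [] := RAB _ _ (jP _ Aa).
  by apply: (Rinj a a' (j a)); [exact: jP | rewrite jj; exact: jP].
move=> /existsNP[a /not_implyP[Aa nRa]].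
have [totB|] := pselect (forall b, B b -> exists a, R (a, b)).
  right; have /choice[j jP] : forall b, exists a, B b -> R (a, b).
    move=> b; have [Bb|nBb] := pselect (B b); last by exists b.
    by have [a' Rab] := totB _ Bb; exists a'.
  exists j => [b Bb|b b' Bb Bb' jj]; first by have [] := RAB _ _ (jP _ Bb).
  by apply: (Rfun (j b) b b'); [exact: jP | rewrite jj; exact: jP].
move=> /existsNP[b /not_implyP[Bb nRb]].
case: (Rmax (R `|` [set (a, b)])).
  split; first by left.
  by move=> /(_ (a, b) (or_intror erefl)) Rab; apply: nRa; exists b.
split=> [a' b' [/RAB //|[-> ->]] //|a' b' b'' [Rab|[-> ->]] [Rab'|]|
         a' a'' b' [Rab|[-> ->]] [Rab'|]].
- exact: Rfun Rab Rab'.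
- by move=> [aa' _]; case: nRa; exists b'; rewrite -aa'.
- by case: nRa; exists b''.
- by move=> [->].
- exact: Rinj Rab Rab'.
- by move=> [_ bb']; case: nRb; exists a'; rewrite -bb'.
- by case: nRb; exists a''.
- by move=> [->].
Qed.

Section Coding.
Variable T : Type.
Implicit Types (R : set (seq T * T)) (s t : seq T) (x : T).

Definition letters R : set T := fun a => exists x, R ([:: a], x).

Definition over (A : set T) s : Prop := forall a, List.In a s -> A a.

(** [R] is the graph of an injection into [letters R] of the nonempty words
    over [letters R]. *)
Definition coding R : Prop :=
  [/\ forall s x, R (s, x) -> [/\ s <> [::], over (letters R) s & letters R x],
      forall s x y, R (s, x) -> R (s, y) -> x = y,
      forall s t x, R (s, x) -> R (t, x) -> s = t &
      forall s, s <> [::] -> over (letters R) s -> exists x, R (s, x)].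

Lemma over_sub (A B : set T) s : A `<=` B -> over A s -> over B s.
Proof. by move=> AB As a /As /AB. Qed.

Lemma coding_bigcup (F : set (set (seq T * T))) :
  F `<=` coding -> total_on F subset -> coding (\bigcup_(R in F) R).
Proof.
move=> FP Ftot; set U := \bigcup_(R in F) R.
have pair z w : U z -> U w -> exists Z, [/\ F Z, Z z & Z w].
  move=> [X FX Xz] [Y FY Yw]; have [XY|YX] := Ftot _ _ FX FY.
    by exists Y; split=> //; exact: XY.
  by exists X; split=> //; exact: YX.
have sub Z : F Z -> letters Z `<=` letters U by move=> FZ a [x Zx]; exists x, Z.
split.
- move=> s x [Z FZ Zx]; have [c _ _ _] := FP _ FZ; have [s0 sZ xZ] := c _ _ Zx.
  by split=> //; [exact: over_sub (sub _ FZ) sZ | exact: sub FZ _ xZ].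
- move=> s x y Ux Uy; have [Z [FZ Zx Zy]] := pair _ _ Ux Uy.
  by have [_ c _ _] := FP _ FZ; exact: c Zx Zy.
- move=> s t x Us Ut; have [Z [FZ Zs Zt]] := pair _ _ Us Ut.
  by have [_ _ c _] := FP _ FZ; exact: c Zs Zt.
move=> s s0 sU; suff [Z FZ Zs] : exists2 Z, F Z & over (letters Z) s.
  by have [_ _ _ c] := FP _ FZ; have [x Zx] := c _ s0 Zs; exists x, Z.
elim: s s0 sU => // a s IHs _ sU.
have [x [X FX Xa]] := sU a (or_introl erefl).
have [s0|s0] := pselect (s = [::]).
  by exists X => // b; rewrite s0 => -[<-|//]; exists x.
have [b bs|Y FY sY] := IHs s0; first by apply: sU; right.
have [XY|YX] := Ftot _ _ FX FY.
  by exists Y => // b [<-|/sY //]; exists x; exact: XY.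
by exists X => // b [<-|/sY [y Yb]]; [exists x|exists y; exact: YX].
Qed.

(** The words over the natural numbers can be numbered. *)
Lemma coding_nat (e : nat -> T) : injective e ->
  exists2 R, coding R & exists z, R z.
Proof.
move=> e_inj; pose R : set (seq T * T) :=
  [set z | exists2 r : seq nat, r <> [::] & z = (map e r, e (pickle r))].
have lR : letters R = range e.
  apply/seteqP; split=> [a [x [[|n [|m r]] // _ [-> _]]]|_ [n _ <-]].
    by exists n.
  by exists (e (pickle [:: n])), [:: n].
have oR s : over (range e) s -> exists r, s = map e r.
  elim: s => [|a s IHs] sR; first by exists [::].
  have [n _ <-] := sR a (or_introl erefl).
  have [|r ->] := IHs; first by move=> b bs; apply: sR; right.
  by exists (n :: r).
exists R; last by exists ([:: e 0%N], e (pickle [:: 0%N])), [:: 0%N].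
split; rewrite ?lR.
- move=> s x [r r0 [-> ->]]; split; last by exists (pickle r).
    by case: r r0.
  by elim: r {r0} => // n r IHr a [<-|/IHr //]; exists n.
- by move=> s x y [r _ [-> ->]] [r' _ [/(inj_map e_inj) -> ->]].
- by move=> s t x [r _ [-> ->]] [r' _ [-> /e_inj /(pcan_inj pickleK) ->]].
move=> s s0 /oR[r sr]; exists (e (pickle r)), r; last by rewrite sr.
by move=> r0; apply: s0; rewrite sr r0.
Qed.

Lemma infinite_injection : infinite_set [set: T] -> exists e : nat -> T, injective e.
Proof.
move=> /infiniteP; case: (pselect (exists _ : T, True)) => [[t _]|noT]; last first.
  by move=> /card_leP[f]; case: noT; exists (val (f (SigSub (mem_setT 0%N)))).
move=> /card_leP[f]; exists (fun n => val (f (SigSub (mem_setT n)))) => n m /val_inj.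
by move/(@inj _ _ _ f) => /(_ (mem_setT _) (mem_setT _)) [].
Qed.

Lemma over_map (A B : set T) (k : T -> T) s :
  (forall a, A a -> B (k a)) -> over A s -> over B (map k s).
Proof.
move=> kB; elim: s => [_ b []|a s IHs As b [<-|]]; first by apply: kB; apply: As; left.
by apply: IHs => c cs; apply: As; right.
Qed.

Lemma map_inj_over (A : set T) (k : T -> T) s t :
  (forall a b, A a -> A b -> k a = k b -> a = b) ->
  over A s -> over A t -> map k s = map k t -> s = t.
Proof.
move=> k_inj; elim: s t => [|a s IHs] [|b t] // sA tA [kab kst].
congr (_ :: _); first by apply: k_inj kab; [apply: sA|apply: tA]; left.
by apply: IHs kst => c cs; [apply: sA|apply: tA]; right.
Qed.

(** A coding of the words over [A] extends to the words over the disjoint union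
    of [A] and a copy [j A] of it: letters are first coded in [A], a repeated
    letter marking those of the copy, and the code is then moved to the copy. *)
Lemma coding_extend R : coding R -> (exists z, R z) ->
  injects (letters R) (~` letters R) -> exists R', coding R' /\ R `<` R'.
Proof.
move=> cR [[s0 x0] Rx0] [j jA j_inj]; have [c1 c2 c3 c4] := cR.
set A := letters R in jA j_inj c1 c2 c3 c4.
have [_ _ Ax0] := c1 _ _ Rx0.
have /choice[cd cdP] : forall s, exists x, s <> [::] -> over A s -> R (s, x).
  move=> s; have [[sn sA]|ns] := pselect (s <> [::] /\ over A s).
    by have [x Rx] := c4 s sn sA; exists x.
  by exists x0 => sn sA; case: ns.
have cdA s : s <> [::] -> over A s -> A (cd s).
  by move=> sn sA; have [_ _] := c1 _ _ (cdP s sn sA).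
have cd_inj s t : s <> [::] -> t <> [::] -> over A s -> over A t -> cd s = cd t -> s = t.
  by move=> sn tn sA tA e; apply: (c3 _ _ (cd s)); [|rewrite e]; exact: cdP.
pose jI := [set x | exists2 a, A a & x = j a].
pose B := A `|` jI.
have /choice[k kP] : forall b, exists x, (A b -> x = cd [:: b]) /\
    (forall a, A a -> b = j a -> x = cd [:: a; a]).
  move=> b; have [[a Aa ->]|nj] := pselect (jI b).
    exists (cd [:: a; a]); split=> [Aj|a' Aa' /j_inj -> //]; by case: (jA a Aa Aj).
  by exists (cd [:: b]); split=> // a Aa ba; case: nj; exists a.
have nn a (s : seq T) : a :: s <> [::] by [].
have one a : A a -> over A [:: a] by move=> Aa b [<-|].
have two a : A a -> over A [:: a; a] by move=> Aa b [<-|[<-|]].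
have kA b : B b -> A (k b).
  case=> [Ab|[a Aa ->]]; first by rewrite (kP b).1 //; apply: cdA => //; exact: one.
  by rewrite ((kP (j a)).2 a) //; apply: cdA => //; exact: two.
have k_inj a b : B a -> B b -> k a = k b -> a = b.
  case=> [Aa|[a' Aa' ->]] [Ab|[b' Ab' ->]].
  - rewrite (kP a).1 // (kP b).1 // => /cd_inj H.
    by have [] := H (nn _ _) (nn _ _) (one _ Aa) (one _ Ab).
  - rewrite (kP a).1 // ((kP (j b')).2 b') // => /cd_inj H.
    by have := H (nn _ _) (nn _ _) (one _ Aa) (two _ Ab').
  - rewrite (kP b).1 // ((kP (j a')).2 a') // => /cd_inj H.
    by have := H (nn _ _) (nn _ _) (two _ Aa') (one _ Ab).
  - rewrite ((kP (j a')).2 a') // ((kP (j b')).2 b') // => /cd_inj H.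
    by have [->] := H (nn _ _) (nn _ _) (two _ Aa') (two _ Ab').
pose N : set (seq T * T) :=
  [set z | [/\ z.1 <> [::], over B z.1, ~ over A z.1 & z.2 = j (cd (map k z.1))]].
have mapk_nn s : s <> [::] -> map k s <> [::] by case: s.
have NB s x : N (s, x) -> exists2 y, A y & x = j y.
  move=> [/= sn sB _ ->]; exists (cd (map k s)) => //.
  by apply: cdA; [exact: mapk_nn | exact: over_map kA sB].
have RN s t x : R (s, x) -> N (t, x) -> False.
  move=> Rs /NB[y Ay xy]; have [_ _ Ax] := c1 _ _ Rs.
  by apply: (jA y Ay); rewrite -xy.
have RNs s x y : R (s, x) -> N (s, y) -> False.
  by move=> Rs [_ _ nA _]; apply: nA; have [] := c1 _ _ Rs.
have lB : letters (R `|` N) = B.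
  apply/seteqP; split=> [a [x [Rax|[/= _ aB _ _]]]|a Ba]; first by left; exists x.
    by apply: aB; left.
  have [[x Rax]|nAa] := pselect (A a); first by exists x; left.
  exists (j (cd (map k [:: a]))); right; split=> //= [b [<-|]//|oA].
  by apply: nAa; apply: oA; left.
have AB : A `<=` B by move=> a Aa; left.
exists (R `|` N); split; last first.
  split; first by left.
  move=> /(_ ([:: j x0], j (cd (map k [:: j x0])))) RN'.
  have oB : over B [:: j x0] by move=> b [<-|//]; right; exists x0.
  have nA : ~ over A [:: j x0] by move=> oA; apply: (jA _ Ax0); apply: oA; left.
  have /RN' Rj : (R `|` N) ([:: j x0], j (cd (map k [:: j x0]))) by right.
  by apply: nA; have [] := c1 _ _ Rj.
split; rewrite ?lB.
- move=> s x [/c1[sn sA Ax]|Nsx]; first by split=> //; [exact: over_sub sA | exact: AB].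
  have [y Ay xy] := NB _ _ Nsx; have [/= sn sB _ _] := Nsx.
  by split=> //; right; exists y.
- move=> s x y [Rx|Nx] [Ry|Ny].
  + exact: c2 Rx Ry.
  + by case: (RNs _ _ _ Rx Ny).
  + by case: (RNs _ _ _ Ry Nx).
  + by have [_ _ _ /= ->] := Nx; have [_ _ _ /= ->] := Ny.
- move=> s t x [Rs|Ns] [Rt|Nt].
  + exact: c3 Rs Rt.
  + by case: (RN _ _ _ Rs Nt).
  + by case: (RN _ _ _ Rt Ns).
  + have [/= sn sB _ xs] := Ns; have [/= tn tB _ xt] := Nt.
    have ks := over_map kA sB; have kt := over_map kA tB.
    apply: (map_inj_over k_inj sB tB); apply: cd_inj => //; try exact: mapk_nn.
    by apply: j_inj; rewrite -?xs //; apply: cdA => //; exact: mapk_nn.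
move=> s sn sB; have [sA|nsA] := pselect (over A s).
  by have [x Rx] := c4 _ sn sA; exists x; left.
by exists (j (cd (map k s))); right.
Qed.

(** In a maximal coding, the letters do not inject into their complement, by
    [coding_extend]. So the complement injects into them, and all elements can
    be coded by letters. *)
Theorem infinite_seq_injective : infinite_set [set: T] ->
  exists f : seq T -> T, injective f.
Proof.
move=> /infinite_injection[e /coding_nat[R0 cR0 [z0 Rz0]]].
have [R [cR Rmax]] := Zorn_bigcup coding_bigcup.
have [z Rz] : exists z, R z.
  apply: contrapT => nR; apply: (Rmax R0) => //; split=> [z Rz|R0R].
    by case: nR; exists z.
  by case: nR; exists z0; exact: R0R.
have [/(coding_extend cR)[|R' [cR' RR']]|] := injects_total (letters R) (~` letters R).
- by exists z.
- by case: (Rmax _ RR').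
move=> [j jA j_inj]; have [c1 c2 c3 c4] := cR.
set A := letters R in jA j_inj c1 c2 c3 c4.
case: z Rz => s0 x0 Rx0; have [_ _ Ax0] := c1 _ _ Rx0.
have /choice[cd cdP] : forall s, exists x, s <> [::] -> over A s -> R (s, x).
  move=> s; have [[sn sA]|ns] := pselect (s <> [::] /\ over A s).
    by have [x Rx] := c4 s sn sA; exists x.
  by exists x0 => sn sA; case: ns.
have cdA s : s <> [::] -> over A s -> A (cd s).
  by move=> sn sA; have [_ _] := c1 _ _ (cdP s sn sA).
have cd_inj s t : s <> [::] -> t <> [::] -> over A s -> over A t -> cd s = cd t -> s = t.
  by move=> sn tn sA tA e'; apply: (c3 _ _ (cd s)); [|rewrite e']; exact: cdP.
have nn a (s : seq T) : a :: s <> [::] by [].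
have one a : A a -> over A [:: a] by move=> Aa b [<-|].
have two a : A a -> over A [:: a; a] by move=> Aa b [<-|[<-|]].
pose k b := if `[< A b >] then cd [:: b] else cd [:: j b; j b].
have kA b : A (k b).
  rewrite /k; case: asboolP => Ab; apply: cdA => //; first exact: one.
  by apply: two; exact: jA.
have k_inj a b : k a = k b -> a = b.
  rewrite /k; case: asboolP => Aa; case: asboolP => Ab => /cd_inj H.
  - by have [] := H (nn _ _) (nn _ _) (one _ Aa) (one _ Ab).
  - by have := H (nn _ _) (nn _ _) (one _ Aa) (two _ (jA _ Ab)).
  - by have := H (nn _ _) (nn _ _) (two _ (jA _ Aa)) (one _ Ab).
  - have [e1 _] := H (nn _ _) (nn _ _) (two _ (jA _ Aa)) (two _ (jA _ Ab)).
    exact: (j_inj _ _ Aa Ab e1).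
(* Only nonempty words have codes, hence the extra letter [x0]. *)
exists (fun s => cd (x0 :: map k s)) => s t.
have ok (r : seq T) : over A (x0 :: map k r).
  by move=> b [<-//|]; apply: (@over_map setT) => // a _.
by move=> /cd_inj H; have [] := H (nn _ _) (nn _ _) (ok _) (ok _) => /(inj_map k_inj).
Qed.

End Coding.

(** * Cardinality *)

Section Cardinality.
Variable G : groupType.

Lemma card_le_injective (T U : Type) (f : T -> U) :
  injective f -> [set: T] #<= [set: U].
Proof.
move=> f_inj; have /card_eqPle[_ le_f] : f @` [set: T] #= [set: T].
  by apply: inj_card_eq => x y _ _; exact: f_inj.
exact: card_le_trans le_f (subset_card_le (@subsetT _ _)).
Qed.

Definition letter : Type := (G + nat + nat + nat)%type.

Definition letter_val (a : letter) : wreath G address :=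
  match a with
  | inl (inl (inl g)) => base g
  | inl (inl (inr n)) => swap_at G n
  | inl (inr n) => spread_at G n
  | inr n => (spread_at G n)^-1%g
  end.

Definition letter_inv (a : letter) : letter :=
  match a with
  | inl (inl (inl g)) => inl (inl (inl g^-1%g))
  | inl (inl (inr n)) => a
  | inl (inr n) => inr n
  | inr n => inl (inr n)
  end.

Definition word_val (s : seq letter) : wreath G address :=
  foldr (fun a w => letter_val a * w)%g 1%g s.

Lemma word_val_cat s t : word_val (s ++ t) = (word_val s * word_val t)%g.
Proof. by elim: s => [|a s IHs] /=; rewrite ?mul1g // IHs mulgA. Qed.

Lemma letter_invP a : letter_val (letter_inv a) = (letter_val a)^-1%g.
Proof.
case: a => [[[g|n]|n]|n] /=; rewrite ?invgK //.
  by apply: wreath_ext => x //=; case: ifP; rewrite ?invg1.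
by apply: wreath_ext => x //=; rewrite invg1.
Qed.

Lemma word_val_rev s :
  word_val (rev (map letter_inv s)) = (word_val s)^-1%g.
Proof.
elim: s => [|a s IHs] /=; first by rewrite invg1.
by rewrite rev_cons -cats1 word_val_cat IHs /= mulg1 letter_invP invgM.
Qed.

Lemma generated_word w : generated (@gens G) w -> exists s, word_val s = w.
Proof.
have sub : is_subgroup [set w | exists s, word_val s = w].
  split=> [|_ _ [s <-] [t <-]|_ [s <-]]; first by exists [::].
    by exists (s ++ t); exact: word_val_cat.
  by exists (rev (map letter_inv s)); exact: word_val_rev.
apply: (generated_min sub) => v [[g ->]|[n [->|->]]].
- by exists [:: inl (inl (inl g))]; rewrite /= mulg1.
- by exists [:: inl (inl (inr n))]; rewrite /= mulg1.
- by exists [:: inl (inr n)]; rewrite /= mulg1.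
Qed.

Theorem card_mext : infinite_set [set: G] -> [set: mext G] #= [set: G].
Proof.
move=> infG; apply/card_eqPle; split; last exact: card_le_injective (@mext_unit_inj G).
have [f f_inj] := infinite_seq_injective infG.
have [e e_inj] := infinite_injection infG.
have /choice[r rP] : forall w : mext G, exists s, word_val s = mext_val w.
  by case=> w /= /asboolP; exact: generated_word.
(* The last entry of a two-letter word records the kind of the letter. *)
pose code (a : letter) : seq G :=
  match a with
  | inl (inl (inl g)) => [:: g]
  | inl (inl (inr n)) => [:: e n; e 0%N]
  | inl (inr n) => [:: e n; e 1%N]
  | inr n => [:: e n; e 2%N]
  end.
have code_inj : injective code.
  by move=> [[[g|n]|n]|n] [[[h|m]|m]|m] //= [];
     by [move=> -> | move=> /e_inj -> | move=> /e_inj -> _ | move=> _ /e_inj].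
have : injective (fun w : mext G => f (map (f \o code) (r w))).
  move=> u w /f_inj /(inj_map (inj_comp f_inj code_inj)) ruw.
  by apply: val_inj; rewrite -[LHS]rP -[RHS]rP ruw.
exact: card_le_injective.
Qed.

End Cardinality.

Theorem corollary1p3 :
  exists (M : group_functor) (i : natural_transformation id_functor M),
    [/\ forall G : groupType,
          [/\ mitotic (M G), acyclic (M G) &
              forall R : realType, bcd R (M G) = 0%E],
        forall G : groupType, injective (i G) &
        forall G : groupType,
          infinite_set [set: G] -> [set: M G] #= [set: G]].
Proof.
exists mext_functor, mext_natural; split=> G.
- have mitG := @mext_mitotic G; split=> // [|R]; first exact: mitotic_acyclic.
  exact: mitotic_bcd.
- exact: mext_unit_inj.
- exact: card_mext.
Qed.
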